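(* Let $K$ be a field and $c\ge 1$ an integer. If $\mathbf{M}$ is a finitely generated graded $\mathrm{OI}$-module over $(\mathbf{X}^{\mathrm{OI},1})^{\otimes c}$ that is generated in non-negative degrees, then its equivariant Hilbert series is of the form \[ H_{\mathbf{M}} (s, t) = \frac{g(s, t)}{(1-t)^a \cdot \prod_{j =1}^b [(1-t)^{c_j} - s \cdot f_j (t)]}, \] where $a, b, c_j$ are non-negative integers with $c_j \le c$, $g (s, t) \in \mathbb{Z}[s, t]$, and each $f_j (t)$ is a polynomial in $\mathbb{Z}[t]$ satisfying $f_j (1) > 0$ and $f_j (0) = 1$.
   Context: $\mathrm{OI}$ is the category with objects $[n] = \{1,\dots,n\}$, $n \ge 0$ ($[0]=\emptyset$), and morphisms the strictly increasing maps $\varepsilon\colon [m]\to[n]$. The $\mathrm{OI}$-algebra $\mathbf{P} = (\mathbf{X}^{\mathrm{OI},1})^{\otimes c}$ over $K$ is the functor from $\mathrm{OI}$ to commutative $K$-algebras with $\mathbf{P}_n = K[x_{i,j} : 1\le i\le c,\ 1\le j\le n]$ (so $\mathbf{P}_0=K$) and, for $\varepsilon\colon[m]\to[n]$, $\varepsilon_*\colon \mathbf{P}_m\to\mathbf{P}_n$ the $K$-algebra homomorphism with $\varepsilon_*(x_{i,j}) = x_{i,\varepsilon(j)}$. Every variable has degree one. An $\mathrm{OI}$-module $\mathbf{M}$ over $\mathbf{P}$ is a functor from $\mathrm{OI}$ to $K$-vector spaces such that each $\mathbf{M}_n = \mathbf{M}([n])$ is a $\mathbf{P}_n$-module and $\mathbf{M}(\varepsilon)(aq)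 = \varepsilon_*(a)\,\mathbf{M}(\varepsilon)(q)$ for all $\varepsilon\colon[m]\to[n]$, $a\in\mathbf{P}_m$, $q\in\mathbf{M}_m$. It is graded if every $\mathbf{M}_n$ is a $\mathbb{Z}$-graded $\mathbf{P}_n$-module and every $\mathbf{M}(\varepsilon)$ is homogeneous of degree $0$. A subset of $\coprod_n\mathbf{M}_n$ generates $\mathbf{M}$ if it is not contained in any proper $\mathrm{OI}$-submodule; $\mathbf{M}$ is finitely generated if it has a finite generating set, and generated in non-negative degrees if it has a generating set consisting of homogeneous elements of non-negative degrees. $[\mathbf{M}_n]_j$ is the degree $j$ component of $\mathbf{M}_n$. The equivariant Hilbert series is the formal power series $H_{\mathbf{M}}(s,t) = \sum_{n\ge0,\,j\in\mathbb{Z}} \dim_K[\mathbf{M}_n]_j\, s^n t^j$. *)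

(* Defs.v *)
From HB Require Import structures.
From mathcomp Require Import all_boot all_order all_algebra.
From mathcomp Require Import mpoly.

Set Implicit Arguments.
Unset Strict Implicit.
Unset Printing Implicit Defensive.

Import Order.TTheory GRing.Theory Num.Theory.
Local Open Scope ring_scope.

(** ** The category OI *)

(* The object [n] is represented by 'I_n = {0, ..., n-1}.  Morphisms are
   finite functions with a boolean monotonicity proof, so that two of them are
   equal as soon as they agree pointwise. *)
Record oi_hom (m n : nat) := OIHom {
  oi_fun :> {ffun 'I_m -> 'I_n};
  oi_incr : [forall i : 'I_m, forall j : 'I_m, (i < j)%N ==> (oi_fun i < oi_fun j)%N]
}.

HB.instance Definition _ m n := [isSub for @oi_fun m n].
HB.instance Definition _ m n := [Finite of oi_hom m n by <:].

Lemma oi_homP (m n : nat) (e : oi_hom m n) : {homo e : i j / (i < j)%N}.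
Proof. by move=> i j; have /forallP/(_ i)/forallP/(_ j)/implyP := oi_incr e. Qed.

Lemma oi_id_incr (n : nat) :
  [forall i : 'I_n, forall j : 'I_n, (i < j)%N ==>
     ([ffun k : 'I_n => k] i < [ffun k : 'I_n => k] j)%N].
Proof. by apply/forallP => i; apply/forallP => j; rewrite !ffunE implybb. Qed.

Definition oi_id (n : nat) : oi_hom n n := OIHom (oi_id_incr n).

Lemma oi_comp_incr (m n p : nat) (d : oi_hom n p) (e : oi_hom m n) :
  [forall i : 'I_m, forall j : 'I_m, (i < j)%N ==>
     ([ffun k => d (e k)] i < [ffun k => d (e k)] j)%N].
Proof.
apply/forallP => i; apply/forallP => j; apply/implyP => ltij.
by rewrite !ffunE; do 2!apply: oi_homP.
Qed.

Definition oi_comp (m n p : nat) (d : oi_hom n p) (e : oi_hom m n) :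
  oi_hom m p := OIHom (oi_comp_incr d e).

(** ** The OI-algebra P = (X^{OI,1})^{(x) c} *)

Notation oi_alg K c n := {mpoly K[(c * n)%N]}.

(* The c * n variables of P_n are indexed by pairs through [mxvec_index],
   the bijection 'I_c * 'I_n -> 'I_(c * n) underlying [mxvec]. *)
Definition oi_var (K : fieldType) (c n : nat) (i : 'I_c) (j : 'I_n) :
  oi_alg K c n := 'X_(mxvec_index i j).

Definition mxvec_unindex (c n : nat) (k : 'I_(c * n)) : 'I_c * 'I_n :=
  enum_val (cast_ord (esym (mxvec_cast c n)) k).

Lemma mxvec_indexK (c n : nat) (i : 'I_c) (j : 'I_n) :
  mxvec_unindex (mxvec_index i j) = (i, j).
Proof. by rewrite /mxvec_unindex /mxvec_index cast_ordK enum_rankK. Qed.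

Definition oi_alg_map (K : fieldType) (c m n : nat) (e : oi_hom m n)
    (p : oi_alg K c m) : oi_alg K c n :=
  p \mPo [tuple oi_var K (mxvec_unindex k).1 (e (mxvec_unindex k).2)
         | k < c * m].

Lemma oi_alg_map_var (K : fieldType) (c m n : nat) (e : oi_hom m n)
    (i : 'I_c) (j : 'I_m) :
  oi_alg_map e (oi_var K i j) = oi_var K i (e j).
Proof.
by rewrite /oi_alg_map /oi_var comp_mpolyXU -tnth_nth tnth_mktuple mxvec_indexK.
Qed.

(** ** OI-modules over P *)

(* The K-vector space structure of M_n is obtained by restricting scalars
   along K -> P_n, a |-> a%:MP; the K-linearity of the structure maps then
   follows from [oi_mapD] and [oi_mapZ]. *)
Record oi_module (K : fieldType) (c : nat) := OIModule {
  oi_obj :> forall n : nat, lmodType (oi_alg K c n);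
  oi_map : forall m n : nat, oi_hom m n -> oi_obj m -> oi_obj n;
  oi_mapD : forall m n (e : oi_hom m n) (x y : oi_obj m),
    oi_map e (x + y) = oi_map e x + oi_map e y;
  oi_mapZ : forall m n (e : oi_hom m n) (a : oi_alg K c m) (q : oi_obj m),
    oi_map e (a *: q) = oi_alg_map e a *: oi_map e q;
  oi_map_id : forall n (q : oi_obj n), oi_map (oi_id n) q = q;
  oi_map_comp : forall m n p (d : oi_hom n p) (e : oi_hom m n) (q : oi_obj m),
    oi_map (oi_comp d e) q = oi_map d (oi_map e q)
}.

(* A subset of the coproduct of the M_n is a family of subsets of the M_n. *)
Definition oi_subset (K : fieldType) (c : nat) (M : oi_module K c) :=
  forall n : nat, M n -> Prop.

Record is_oi_submodule (K : fieldType) (c : nat) (M : oi_module K c)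
    (N : oi_subset M) : Prop := IsOISubmodule {
  oi_sub0 : forall n, N n 0;
  oi_subD : forall n (x y : M n), N n x -> N n y -> N n (x + y);
  oi_subZ : forall n (a : oi_alg K c n) (q : M n), N n q -> N n (a *: q);
  oi_sub_map : forall m n (e : oi_hom m n) (q : M m),
    N m q -> N n (oi_map e q)
}.

Definition oi_generates (K : fieldType) (c : nat) (M : oi_module K c)
    (S : oi_subset M) : Prop :=
  forall N : oi_subset M, is_oi_submodule N ->
    (forall n (q : M n), S n q -> N n q) -> forall n (q : M n), N n q.

Definition oi_finitely_generated (K : fieldType) (c : nat)
    (M : oi_module K c) : Prop :=
  exists s : seq {n : nat & M n},
    oi_generates (fun n (q : M n) => existT (fun k => M k) n q \in s).

(** ** Graded OI-modules *)

(* [goi_comp n j] is the degree j component [M_n]_j; M_n is their internal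
   direct sum by [goi_sum] and [goi_direct]. The polynomial ring P_n carries
   its standard grading, and [goi_compZ] with d = 0 makes every component a
   K-subspace. *)
Record graded_oi_module (K : fieldType) (c : nat) := GradedOIModule {
  goi_module :> oi_module K c;
  goi_comp : forall n : nat, int -> goi_module n -> Prop;
  goi_comp0 : forall n j, @goi_comp n j 0;
  goi_compD : forall n j (x y : goi_module n),
    goi_comp j x -> goi_comp j y -> goi_comp j (x + y);
  goi_compZ : forall n (d : nat) j (a : oi_alg K c n) (q : goi_module n),
    a \is d.-homog -> goi_comp j q -> goi_comp (d%:Z + j) (a *: q);
  goi_sum : forall n (q : goi_module n),
    exists (s : seq int) (u : int -> goi_module n),
      (forall j, goi_comp j (u j)) /\ q = \sum_(j <- s) u j;
  goi_direct : forall n (s : seq int) (u : int -> goi_module n),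
    uniq s -> (forall j, goi_comp j (u j)) -> \sum_(j <- s) u j = 0 ->
    forall j, j \in s -> u j = 0;
  goi_map : forall m n (e : oi_hom m n) j (q : goi_module m),
    goi_comp j q -> goi_comp j (oi_map e q)
}.

Definition goi_generated_nonneg (K : fieldType) (c : nat)
    (M : graded_oi_module K c) : Prop :=
  exists S : oi_subset M, oi_generates S /\
    forall n (q : M n), S n q -> exists2 j : int, 0 <= j & goi_comp j q.

(** ** Equivariant Hilbert series *)

(* The K-subspace V of the P_n-module U has K-dimension d: it has a K-basis
   of d vectors. *)
Definition has_dim (K : fieldType) (r : nat) (U : lmodType {mpoly K[r]})
    (V : U -> Prop) (d : nat) : Prop :=
  exists v : 'I_d -> U,
    [/\ forall i, V (v i),
        forall q, V q -> exists a : 'I_d -> K, q = \sum_i (a i)%:MP *: v i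
      & forall a : 'I_d -> K, \sum_i (a i)%:MP *: v i = 0 ->
          forall i, a i = 0].

(* [H n j] is the coefficient of s^n t^j.  In particular all the [M_n]_j are
   finite-dimensional when such an H exists. *)
Definition is_hilbert_series (K : fieldType) (c : nat)
    (M : graded_oi_module K c) (H : nat -> int -> nat) : Prop :=
  forall (n : nat) (j : int), has_dim (@goi_comp K c M n j) (H n j).

(* A polynomial in Z[s,t] is an element of Z[t][s] = {poly {poly int}}, so
   that [p`_n`_j] is its coefficient of s^n t^j.  [is_fraction H g D] means
   that H lies in Z[[s,t]] (no negative power of t occurs) and that D * H = g
   in Z[[s,t]]; if D has constant coefficient 1 then D is a unit of Z[[s,t]],
   and this is H = g / D. *)
Definition is_fraction (H : nat -> int -> nat) (g D : {poly {poly int}}) :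
    Prop :=
  (forall (n : nat) (j : int), j < 0 -> H n j = 0%N) /\
  (forall n j : nat,
     \sum_(k < n.+1) \sum_(l < j.+1)
        D`_k`_l * (H (n - k)%N (j - l)%N%:Z)%:Z = g`_n`_j).

(* (1 - t)^a * \prod_{j < b} ((1 - t)^{c_j} - s f_j(t)); here the outer
   indeterminate 'X is s and the inner one is t. *)
Definition hilbert_denom (a b : nat) (cs : 'I_b -> nat)
    (f : 'I_b -> {poly int}) : {poly {poly int}} :=
  ((1 - 'X) ^+ a)%:P *
  \prod_(j < b) (((1 - 'X) ^+ cs j)%:P - 'X * (f j)%:P).

Lemma hilbert_denom_const (a b : nat) (cs : 'I_b -> nat)
    (f : 'I_b -> {poly int}) : (hilbert_denom a cs f)`_0`_0 = 1.
Proof.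
rewrite -!horner_coef0 /hilbert_denom hornerM hornerC hornerM.
rewrite horner_exp hornerD hornerN hornerC hornerX oppr0 addr0 expr1n mul1r horner_prod.
elim/big_rec: _ => [|j p _ IH]; first by rewrite hornerC.
rewrite hornerM IH hornerD hornerN hornerM hornerX mul0r oppr0 addr0 hornerC.
by rewrite horner_exp hornerD hornerN hornerC hornerX oppr0 addr0 expr1n mul1r.
Qed.

(* Main.v *)
Require Import Defs.
From mathcomp Require Import all_boot all_order all_algebra.
From mathcomp Require Import mpoly.
From mathcomp Require Import zify ring.
From Stdlib Require Import Classical ClassicalEpsilon.
Set Implicit Arguments.
Unset Strict Implicit.
Unset Printing Implicit Defensive.
Import Order.TTheory GRing.Theory Num.Theory.
Local Open Scope ring_scope.

(** Let g_1, ..., g_k be homogeneous generators of M, of widths d_i and degrees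
    e_i >= 0.  Over K, the space M_n is spanned by the products of a monomial m
    of P_n with the image of some g_i under some OI-morphism e from [d_i] to
    [n].  Such a pair (m, e) is recorded as a word of length n: its j-th letter
    consists of the exponents in m of the c variables of column j, and of a mark
    telling whether j lies in the image of e.  Order the pairs (i, word)
    lexicographically, and call such a pair standard if its vector is not a
    K-combination of the vectors of smaller pairs of the same width and degree.
    The standard pairs give a basis of M ([has_dim_standard]), so the Hilbert
    series is the sum over i of t^(e_i) times the generating function of the
    words that are standard for g_i.

    Applying an OI-morphism and multiplying by a monomial are strictly monotone
    on words ([stretch_lt]).  A linear relation that makes a word nonstandard is
    therefore transported to all words above it in Higman's embedding order
    having the same number of marks ([standard_word_emb]).  So the words that are
    standard for g_i or have fewer than d_i marks form a downset, and so do the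
    words with fewer than d_i marks; the generating function in question is the
    difference of the generating functions of these two downsets.

    What remains is the combinatorial core ([downset_rational]): the generating
    function of a downset L of words with a bounded number of marks has the
    required form.  By Higman's lemma downsets satisfy the descending chain
    condition ([downset_dcc]), so one can argue by induction on L.  A nonempty
    word of L is a letter x followed by a word of the residual of L by x, which is
    a downset contained in L and shrinks as x grows.  Dickson's lemma together
    with the chain condition cuts the set of exponent vectors into finitely many
    boxes, given by fixing some coordinates and bounding the others from below,
    on each of which the residual is constant ([box_partition]).  The box with
    corner p and r free coordinates has generating function t^|p| / (1 - t)^r.
    Boxes whose residual is smaller than L are covered by the induction, and those
    whose residual is L give a fixed point equation with solution involving
    1 / ((1 - t)^k - s f), where k <= c is the largest number of free
    coordinates among them and f is the sum of t^|p| (1 - t)^(k - r).  Thus f(1)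
    is the number of these boxes with k free coordinates, and f(0) is the number
    of them with corner 0; there is exactly one of the latter, since the residual
    by the zero vector is the largest one. *)

(** * Well-quasi-orders: the lemmas of Dickson and Higman *)

(** The classical form of well-quasi-order (every infinite sequence has a
    good pair), relative to a domain [P]: exponent vectors are lists, and only
    lists of one fixed length are well-quasi-ordered. *)
Definition wqo_on (T : Type) (P : T -> Prop) (le : T -> T -> Prop) :=
  forall f : nat -> T, (forall i, P (f i)) ->
  exists i j, (i < j)%N /\ le (f i) (f j).

Lemma increasing_homo (g : nat -> nat) :
  (forall i, (g i < g i.+1)%N) -> {homo g : i j / (i < j)%N}.
Proof. by move=> gS; apply: homo_ltn => //; apply: ltn_trans. Qed.

Lemma increasing_ge (g : nat -> nat) (i : nat) :
  (forall i, (g i < g i.+1)%N) -> (g 0 + i <= g i)%N.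
Proof. by move=> gS; elim: i => [|i IH]; [rewrite addn0|have := gS i; lia]. Qed.

(** A term with no later term above it is called terminal here.  Only finitely
    many terms are terminal, for otherwise they would form a sequence without
    good pair; past the last of them one can climb forever. *)
Lemma wqo_on_mono (T : Type) (P : T -> Prop) (le : T -> T -> Prop)
    (f : nat -> T) :
  (forall x y z, le x y -> le y z -> le x z) ->
  wqo_on P le -> (forall i, P (f i)) ->
  exists g : nat -> nat, (forall i, (g i < g i.+1)%N) /\
    forall i j, (i < j)%N -> le (f (g i)) (f (g j)).
Proof.
move=> le_tr wq Pf.
have [N HN] : exists N, forall i, (N <= i)%N ->
    exists j, (i < j)%N /\ le (f i) (f j).
  apply: NNPP => noN.
  have /ClassicalEpsilon.choice[h Hh] : forall N, exists i,
      (N <= i)%N /\ forall j, (i < j)%N -> ~ le (f i) (f j).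
    move=> N; apply: NNPP => noi; apply: noN; exists N => i leNi.
    apply: NNPP => noj; apply: noi; exists i; split=> // j ltij lef.
    by apply: noj; exists j.
  pose k m := iter m (fun x => h x.+1) (h 0).
  have kS m : (k m < k m.+1)%N by rewrite /k iterS; case: (Hh (k m).+1).
  have [i [j [ltij lef]]] := wq (f \o k) (fun i => Pf (k i)).
  have : exists x, k i = h x by case: i {ltij lef} => [|i]; [exists 0%N|eexists].
  case=> x kx; case: (Hh x) => _ /(_ (k j)); rewrite -kx => H.
  by apply: H lef; apply: increasing_homo.
have /ClassicalEpsilon.choice[h Hh] : forall i, exists j, (N <= i)%N ->
    (i < j)%N /\ le (f i) (f j).
  move=> i; case: (leqP N i) => [leNi|_]; last by exists 0%N.
  by have [j] := HN i leNi; exists j.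
pose g m := iter m h N.
have gN m : (N <= g m)%N.
  elim: m => [|m IH]; [exact: leqnn|apply: (leq_trans IH (ltnW _))].
  by case: (Hh _ IH).
have gS m : (g m < g m.+1)%N /\ le (f (g m)) (f (g m.+1)) by apply: Hh.
exists g; split=> [i|]; first by case: (gS i).
move=> i; elim=> [//|j IH]; rewrite ltnS leq_eqVlt => /orP[/eqP->|/IH lef].
  by case: (gS j).
by apply: le_tr lef _; case: (gS j).
Qed.

Definition mon_le (a b : seq nat) := all2 leq a b.

Lemma mon_le_trans a b d : mon_le a b -> mon_le b d -> mon_le a d.
Proof.
elim: a b d => [|x a IH] [|y b] [|z d] //= /andP[xy ab] /andP[yz bd].
by rewrite (leq_trans xy yz) (IH b).
Qed.

Lemma mon_le_refl a : mon_le a a.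
Proof. by elim: a => //= x a; rewrite leqnn. Qed.

Lemma wqo_nat : wqo_on (fun _ : nat => True) leq.
Proof.
move=> f _; apply: NNPP => bad.
have H i : (f i + i <= f 0)%N.
  elim: i => [|i IH]; first by rewrite addn0.
  have : ~ (f i <= f i.+1)%N by move=> le; apply: bad; exists i, i.+1.
  by lia.
by have := H (f 0%N).+1; move: (f (f 0%N).+1) (f 0%N) => p q; lia.
Qed.

Lemma dickson c : wqo_on (fun a : seq nat => size a = c) mon_le.
Proof.
elim: c => [|c IH] f fP.
  by exists 0%N, 1%N; rewrite (size0nil (fP 0%N)) (size0nil (fP 1%N)).
have [g [gS gle]] := wqo_on_mono (f := fun i => head 0%N (f i))
  (fun x y z => @leq_trans y x z) wqo_nat (fun=> I).
have [|i [j [ltij le]]] := IH (fun i => behead (f (g i))).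
  by move=> i; rewrite size_behead fP.
exists (g i), (g j); split; first exact: increasing_homo.
move: (gle _ _ ltij) le (fP (g i)) (fP (g j)).
by case: (f (g i)) => // x a; case: (f (g j)) => //= y b -> ->.
Qed.

Notation letter := (seq nat * bool)%type.
Notation word := (seq letter).

(** A letter is an exponent vector with a mark.  Marks have to agree, because
    they will record the image of an OI-morphism, which multiplication by a
    monomial does not move. *)
Definition letter_le (x y : letter) := (x.2 == y.2) && mon_le x.1 y.1.

Lemma letter_le_trans x y z : letter_le x y -> letter_le y z -> letter_le x z.
Proof.
by move=> /andP[/eqP e1 l1] /andP[/eqP e2 l2];
  rewrite /letter_le e1 e2 eqxx (mon_le_trans l1 l2).
Qed.

Definition letter_in (c : nat) (x : letter) := size x.1 == c.
Definition word_in (c : nat) (w : word) := all (letter_in c) w.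

Lemma wqo_letter c : wqo_on (letter_in c) letter_le.
Proof.
move=> f fP.
have [g [gS gle]] := wqo_on_mono (f := fun i => (f i).1)
  mon_le_trans (@dickson c) (fun i => eqP (fP i)).
(* there are two marks, so two of three indices carry the same one *)
have H i j : (i < j)%N -> (f (g i)).2 = (f (g j)).2 ->
    exists i j, (i < j)%N /\ letter_le (f i) (f j).
  move=> lt e; exists (g i), (g j); split; first exact: increasing_homo.
  by rewrite /letter_le e eqxx gle.
case: (boolP ((f (g 0%N)).2 == (f (g 1%N)).2)) => [/eqP/H|e01]; first exact.
case: (boolP ((f (g 0%N)).2 == (f (g 2%N)).2)) => [/eqP/H|e02]; first exact.
apply: (H 1%N 2%N) => //.
by move: e01 e02; case: (f (g 0%N)).2; case: (f (g 1%N)).2; case: (f (g 2%N)).2.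
Qed.

(** Higman's order.  Skipping a marked letter is allowed, so that the lemma of
    Higman applies as it stands; the words that come from one generator all
    have the same number of marks, and between such words only unmarked letters
    get skipped. *)
Inductive emb : word -> word -> Prop :=
| emb_nil w : emb [::] w
| emb_skip x u w : emb u w -> emb u (x :: w)
| emb_cons x y u w : letter_le x y -> emb u w -> emb (x :: u) (y :: w).

Lemma emb_refl w : emb w w.
Proof.
elim: w => [|x w IH]; first exact: emb_nil.
by apply: emb_cons; rewrite // /letter_le eqxx mon_le_refl.
Qed.

Lemma letter_le_in c x y : letter_le x y -> letter_in c y -> letter_in c x.
Proof. by rewrite /letter_le /mon_le all2E /letter_in => /and3P[_ /eqP->]. Qed.

Lemma emb_in c u w : emb u w -> word_in c w -> word_in c u.
Proof.
elim=> [//|x {}u {}w _ IH /= /andP[_ /IH]//|x y {}u {}w xy _ IH /= /andP[yc /IH->]].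
by rewrite (letter_le_in xy).
Qed.

(** Nash-Williams' argument.  Build a bad sequence [F] by choosing each term
    as short as possible among the continuations to a bad sequence.  Its terms
    are nonempty; along a subsequence on which the first letters increase,
    dropping these letters gives a bad sequence that contradicts the choice of
    the first term of the subsequence. *)
Lemma higman c : wqo_on (word_in c) emb.
Proof.
(* [ext p]: the finite sequence [p] starts some bad sequence *)
pose bad (f : nat -> word) := (forall i, word_in c (f i)) /\
  forall i j, (i < j)%N -> ~ emb (f i) (f j).
pose ext (p : seq word) := exists2 f, bad f & mkseq f (size p) = p.
move=> f0 f0P; apply: NNPP => nogood.
have ext0 : ext [::].
  by exists f0 => //; split=> // i j ltij e; apply: nogood; exists i, j.
have /ClassicalEpsilon.choice[nxt nxtP] : forall p, exists w, ext p ->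
    ext (rcons p w) /\ forall w', ext (rcons p w') -> (size w <= size w')%N.
  move=> p; case: (classic (ext p)) => [[f fb fp]|]; last by exists [::].
  have : exists n, exists2 w, ext (rcons p w) & size w = n.
    exists (size (f (size p))), (f (size p)) => //.
    by exists f => //; rewrite size_rcons mkseqS fp.
  case=> n; elim/ltn_ind: n => n IH [w we wn].
  case: (classic (exists2 w', ext (rcons p w') & (size w' < n)%N)).
    by case=> w' w'e w'n; apply: IH w'n _; exists w'.
  move=> nmin; exists w => _; split=> // w' w'e; rewrite wn leqNgt.
  by apply/negP => lt; apply: nmin; exists w'.
pose pre n := iter n (fun p => rcons p (nxt p)) [::].
pose F n := nxt (pre n).
have preE n : pre n = mkseq F n.
  by elim: n => [//|n IH]; rewrite mkseqS -IH.
have extF n : ext (mkseq F n).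
  rewrite -preE; elim: n => [//|n IH]; exact: (nxtP _ IH).1.
have minF n w : ext (rcons (mkseq F n) w) -> (size (F n) <= size w)%N.
  by move=> wE; have := (nxtP _ (extF n)).2 w wE; rewrite -preE.
have Fext n f : mkseq f n = mkseq F n -> forall i, (i < n)%N -> f i = F i.
  by move=> e i lti; have := congr1 (nth [::] ^~ i) e; rewrite !nth_mkseq.
have badF : bad F.
  split=> [i|i j ltij].
    have [f [fP _] e] := extF i.+1; rewrite size_mkseq in e.
    by rewrite -(Fext _ _ e).
  have [f [_ fb] e] := extF j.+1; rewrite size_mkseq in e.
  by rewrite -!(Fext _ _ e) //; [exact: fb|lia].
have [FP Fb] := badF.
have Fnil n : F n <> [::].
  by move=> e; apply: (Fb n n.+1) => //; rewrite e; constructor.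
pose a n := head ([::], false) (F n); pose u n := behead (F n).
have Fau n : F n = a n :: u n by rewrite /a /u; case: (F n) (Fnil n).
have aP n : letter_in c (a n) by have := FP n; rewrite Fau => /andP[].
have [g [gS gle]] := wqo_on_mono letter_le_trans (@wqo_letter c) aP.
(* keep [F] up to the first index of the subsequence, and continue with the
   tails [u] along the subsequence *)
pose G n := if (n < g 0)%N then F n else u (g (n - g 0)%N).
have : ext (rcons (mkseq F (g 0)) (u (g 0))).
  exists G; last first.
    rewrite size_rcons size_mkseq mkseqS; congr rcons.
      by apply/eq_in_map => i; rewrite mem_iota /G => /andP[_ ->].
    by rewrite /G ltnn subnn.
  split=> [i|i j ltij]; rewrite /G.
    case: ifP => _; first exact: FP.
    by have := FP (g (i - g 0)%N); rewrite Fau => /andP[].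
  case: (ltnP i) => ltig; case: (ltnP j) => ltjg; try by [lia|exact: Fb].
    have gj := increasing_ge (j - g 0)%N gS.
    move=> e; apply: (Fb i (g (j - g 0)%N)); first lia.
    by rewrite [F (g _)]Fau; apply: emb_skip.
  have lt : (i - g 0 < j - g 0)%N by lia.
  move=> e; apply: (Fb _ _ (increasing_homo gS lt)).
  by rewrite !Fau; apply: emb_cons => //; apply: gle.
by move/minF; rewrite Fau /= ltnn.
Qed.

(** * Downsets of words and antitone families indexed by exponent vectors *)

Section Downsets.
Variable c : nat.

Definition word_sub (L L' : pred word) := forall w, word_in c w -> L w -> L' w.
Definition downset (L : pred word) :=
  forall u w, word_in c w -> emb u w -> L w -> L u.

(** Words witnessing the strict inclusions form a sequence without good
    pair. *)
Lemma downset_dcc (F : nat -> pred word) : (forall i, downset (F i)) ->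
  (forall i, word_sub (F i.+1) (F i)) -> ~ (forall i, ~ word_sub (F i) (F i.+1)).
Proof.
move=> Fd Fs Fn.
have /ClassicalEpsilon.choice[w wP] : forall i, exists w,
    word_in c w /\ F i w /\ ~ F i.+1 w.
  move=> i; apply: NNPP => no; apply: (Fn i) => w wc Fw.
  by apply: NNPP => nF; apply: no; exists w.
have Fsub i j : (i <= j)%N -> word_sub (F j) (F i).
  move=> leij; rewrite -(subnK leij); elim: (j - i)%N => [|k IH] // v vc.
  by move=> /(Fs _ v vc); apply: IH.
have [i [j [ltij e]]] := @higman c w (fun i => (wP i).1).
have [wi [_ nFi]] := wP i; have [wj [Fj _]] := wP j.
by apply: nFi; apply: (Fd _ _ _ wj e); apply: (Fsub _ _ ltij).
Qed.

Lemma downset_ind (Q : pred word -> Prop) :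
  (forall L, downset L ->
     (forall L', downset L' -> word_sub L' L -> ~ word_sub L L' -> Q L') -> Q L) ->
  forall L, downset L -> Q L.
Proof.
move=> Qstep L0 L0d; apply: NNPP => nQ0.
have /ClassicalEpsilon.choice[nxt nP] : forall L, exists L', downset L -> ~ Q L ->
    [/\ downset L', ~ Q L', word_sub L' L & ~ word_sub L L'].
  move=> L; apply: NNPP => no; have [Ld nQ] : downset L /\ ~ Q L.
    by split; apply: NNPP => H; apply: no; exists L.
  apply: nQ; apply: Qstep => // L' L'd s ns; apply: NNPP => nQ'.
  by apply: no; exists L'.
pose F i := iter i nxt L0.
have FP i : downset (F i) /\ ~ Q (F i).
  by elim: i => [//|i [Fd nQ]]; have [] := nP _ Fd nQ.
have FS i := let: conj d q := FP i in nP _ d q.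
apply: (@downset_dcc F) => i; first by case: (FP i).
  by have := FS i; case: (FP i) => d q; case.
by have := FS i; case: (FP i) => d q; case.
Qed.

(** A box prescribes for each coordinate either its value or, if the boolean is
    true (a free coordinate), only a lower bound.  The point made of these
    values and bounds is its corner. *)
Definition in_box (B : seq (nat * bool)) (a : seq nat) :=
  all2 (fun (x : nat * bool) k => if x.2 then (x.1 <= k)%N else k == x.1) B a.
Definition corner (B : seq (nat * bool)) := [seq x.1 | x <- B].

Definition antitone (m : nat) (phi : seq nat -> pred word) :=
  forall a b, size a = m -> mon_le a b -> word_sub (phi b) (phi a).

(** Otherwise there are arbitrarily large first coordinates at which the
    family still drops, at some tail [a].  By Dickson's lemma the tails may be
    taken increasing, and the values of the family along these points then
    form a strictly decreasing sequence of downsets. *)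
Lemma antitone_stabilizes m (phi : seq nat -> pred word) :
  (forall a, size a = m.+1 -> downset (phi a)) -> antitone m.+1 phi ->
  exists K, forall k a, size a = m -> (K <= k)%N ->
    word_sub (phi (K :: a)) (phi (k :: a)).
Proof.
move=> phid anti; apply: NNPP => no.
have /ClassicalEpsilon.choice[h hP] : forall K, exists x : nat * seq nat,
    [/\ size x.2 = m, (K < x.1)%N & ~ word_sub (phi (K :: x.2)) (phi (x.1 :: x.2))].
  move=> K; apply: NNPP => no'; apply: no; exists K => k a am leKk.
  case: (ltngtP K k) leKk => // [ltKk|<-] _ //.
  by apply: NNPP => ns; apply: no'; exists (k, a).
(* [k] runs through first coordinates such that the family drops between
   [k i] and [k i.+1] at the tail [(h (k i)).2] *)
pose k m := iter m (fun x => (h x).1) 0%N.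
have kS i : (k i < k i.+1)%N.
  by rewrite /k iterS; case: (hP (iter i (fun x => (h x).1) 0%N)).
have sz i : size (h (k i)).2 = m by case: (hP (k i)).
have [g [gS gle]] := wqo_on_mono mon_le_trans (@dickson m) sz.
have kge i j : (i <= j)%N -> (k i <= k j)%N.
  by case: ltngtP => // [lt|->] // _; rewrite ltnW // increasing_homo.
apply: (@downset_dcc (fun i => phi (k (g i) :: (h (k (g i))).2))) => i.
- by apply: phid; rewrite /= sz.
- apply: anti; rewrite /= ?sz // gle // andbT; apply: kge; exact: ltnW.
- case: (hP (k (g i))) => _ _ ns s; apply: ns => w wc /(s w wc).
  apply: anti; rewrite //= ?sz // gle // andbT.
  exact: (kge (g i).+1).
Qed.

(** Induction on the number of coordinates: once the first coordinate reaches
    a bound [K] its value is irrelevant and it becomes free, while each of the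
    finitely many smaller values is treated on its own. *)
Lemma box_partition m (phi : seq nat -> pred word) :
  (forall a, size a = m -> downset (phi a)) -> antitone m phi ->
  exists bs : seq (seq (nat * bool)),
    [/\ forall B, B \in bs -> size B = m,
        forall a, size a = m -> count (in_box ^~ a) bs = 1%N
      & forall B a, B \in bs -> in_box B a ->
          word_sub (phi (corner B)) (phi a) /\ word_sub (phi a) (phi (corner B))].
Proof.
elim: m phi => [|m IH] phi phid anti.
  exists [:: [::]]; split=> [B|a /size0nil -> //|B a]; rewrite inE => /eqP -> //.
  by case: a => // _; split=> w.
have [K HK] := antitone_stabilizes phid anti.
have /ClassicalEpsilon.choice[bsf bsP] : forall k, exists bs : seq (seq (nat * bool)),
    [/\ forall B, B \in bs -> size B = m,
        forall a, size a = m -> count (in_box ^~ a) bs = 1%N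
      & forall B a, B \in bs -> in_box B a ->
          word_sub (phi (k :: corner B)) (phi (k :: a)) /\
          word_sub (phi (k :: a)) (phi (k :: corner B))].
  move=> k; apply: (IH (fun a => phi (k :: a))) => [a am|a b am ab].
    by apply: phid; rewrite /= am.
  by apply: anti; rewrite /= ?am ?leqnn.
have size_box B a : in_box B a -> size B = size a.
  by rewrite /in_box all2E => /andP[/eqP].
exists ([seq (K, true) :: B | B <- bsf K] ++
  flatten [seq [seq (k, false) :: B | B <- bsf k] | k <- iota 0 K]); split.
- move=> B; rewrite mem_cat => /orP[/mapP[B' B'bs ->]|].
    by case: (bsP K) => /(_ _ B'bs) /= ->.
  case/flattenP => _ /mapP[k _ ->] /mapP[B' B'bs ->].
  by case: (bsP k) => /(_ _ B'bs) /= ->.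
- case=> [//|k a] [am]; rewrite count_cat count_map.
  have -> : count (preim (cons (K, true)) (in_box^~ (k :: a))) (bsf K) = (K <= k)%N.
    case: (leqP K k) => leK; last first.
      apply/eqP; rewrite -leqn0 leqNgt -has_count; apply/hasPn => B _ /=.
      by rewrite leqNgt leK.
    have [_ /(_ a am) bs1 _] := bsP K; apply: etrans bs1.
    by apply: eq_count => B /=; rewrite leK.
  suff -> : count (in_box^~ (k :: a))
     (flatten [seq [seq (k0, false) :: B | B <- bsf k0] | k0 <- iota 0 K]) = (k < K)%N.
    by case: ltnP.
  have : (k < K)%N = (k \in iota 0 K) by rewrite mem_iota.
  move=> ->; have := iota_uniq 0 K; elim: (iota 0 K) => //= i r IHr /andP[ir ur].
  rewrite count_cat IHr // count_map inE.
  case: (k =P i) => [->|/eqP ki] /=.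
    have [_ /(_ a am) bs1 _] := bsP i.
    rewrite (negPf ir) addn0; apply: etrans bs1.
    by apply: eq_count => B /=; rewrite eqxx.
  suff -> : count (preim (cons (i, false)) (in_box^~ (k :: a))) (bsf i) = 0%N by [].
  apply/eqP; rewrite -leqn0 leqNgt -has_count; apply/hasPn => B _ /=.
  by rewrite (negPf ki).
- move=> B a; rewrite mem_cat => /orP[/mapP[B' B'bs ->]|].
    case: a => [//|k a] /andP[/= leK inB].
    have [Bs _ /(_ B' a B'bs inB)[s1 s2]] := bsP K.
    have am : size a = m by rewrite -(size_box _ _ inB) Bs.
    split=> w wc; first by move/(s1 w wc); apply: HK.
    move=> H; apply: s2 => //; move: w wc H; apply: anti => /=.
      by rewrite am.
    by rewrite leK mon_le_refl.
  case/flattenP => _ /mapP[i _ ->] /mapP[B' B'bs ->].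
  case: a => [//|k a] /andP[/= /eqP -> inB].
  by have [_ _ /(_ B' a B'bs inB)] := bsP i.
Qed.

End Downsets.

(** * Enumeration of words by length and degree *)

Section Enum.
Variable c : nat.

Fixpoint exponents (m l : nat) : seq (seq nat) :=
  if m is m'.+1 then [seq k :: a | k <- iota 0 l.+1, a <- exponents m' (l - k)]
  else if l is 0 then [:: [::]] else [::].

Lemma exponentsS m l :
  exponents m.+1 l = [seq k :: a | k <- iota 0 l.+1, a <- exponents m (l - k)].
Proof. by []. Qed.

Lemma mem_exponents m l a : (a \in exponents m l) = (size a == m) && (sumn a == l).
Proof.
elim: m l a => [|m IH] l a; first by case: l a => [|l] [|x a].
rewrite exponentsS; apply/allpairsPdep/andP => [[k [b [/[!mem_iota] kl]]]|].
  by rewrite IH => /andP[/eqP bm /eqP bl] ->; rewrite /= bm bl; lia.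
case: a => [|k a] [] // /eqP[am] /eqP al; exists k, a.
by rewrite /= in al; rewrite mem_iota IH am eqxx; split=> //; lia.
Qed.

Lemma uniq_exponents m l : uniq (exponents m l).
Proof.
elim: m l => [|m IH] l; first by case: l.
rewrite exponentsS.
apply: allpairs_uniq_dep => [|k _|[k a] [k' a'] _ _ /= [-> ->]] //.
exact: iota_uniq.
Qed.

Definition letters (l : nat) : seq letter :=
  [seq (a, b) | a <- exponents c l, b <- [:: false; true]].

Lemma mem_letters l x : (x \in letters l) = letter_in c x && (sumn x.1 == l).
Proof.
apply/allpairsPdep/idP => [[a [b [ain _ ->]]]|].
  by rewrite mem_exponents in ain.
by case: x => a b xin; exists a, b; rewrite mem_exponents; split=> //; case: b xin.
Qed.

Lemma uniq_letters l : uniq (letters l).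
Proof.
apply: allpairs_uniq => //; first exact: uniq_exponents.
by move=> [a b] [a' b'] _ _ /= [-> ->].
Qed.

Definition wdeg (w : word) := sumn [seq sumn x.1 | x <- w].

Fixpoint words (n j : nat) : seq word :=
  if n is n'.+1 then
    [seq p.2 :: w | p <- [seq (l, x) | l <- iota 0 j.+1, x <- letters l],
                    w <- words n' (j - p.1)]
  else if j is 0 then [:: [::]] else [::].

Lemma wordsS n j : words n.+1 j =
  [seq p.2 :: w | p <- [seq (l, x) | l <- iota 0 j.+1, x <- letters l],
                  w <- words n (j - p.1)].
Proof. by []. Qed.

Lemma mem_words n j w :
  (w \in words n j) = [&& size w == n, word_in c w & wdeg w == j].
Proof.
elim: n j w => [|n IH] j w; first by case: j w => [|j] [|x w].
rewrite wordsS; apply/allpairsPdep/and3P.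
  move=> [_ [v [/allpairsPdep[l [x [/[!mem_iota] lj xl ->]]]]]].
  rewrite /= IH => /and3P[/eqP sv vc /eqP vj] ->.
  move: xl; rewrite mem_letters => /andP[xc /eqP xl].
  by rewrite /= sv xc vc /wdeg /= -/(wdeg v) xl vj; split=> //; lia.
case: w => [|x w] [] // /eqP[sw] /andP[xc wc] /eqP wj.
have {}wj : (sumn x.1 + wdeg w = j)%N by [].
rewrite -[_ w]/(word_in c w) in wc.
exists (sumn x.1, x), w; rewrite IH sw wc eqxx.
split=> //; last by rewrite /= -wj addKn.
apply/allpairsPdep; exists (sumn x.1), x; rewrite mem_iota mem_letters xc eqxx.
by split=> //=; rewrite add0n ltnS -wj leq_addr.
Qed.

Lemma uniq_words n j : uniq (words n j).
Proof.
elim: n j => [|n IH] j; first by case: j.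
rewrite wordsS; apply: allpairs_uniq_dep => //.
  apply: allpairs_uniq_dep; first exact: iota_uniq.
    by move=> l _; apply: uniq_letters.
  by move=> [l x] [l' x'] _ _ /= [-> ->].
move=> [[l x] w] [[l' x'] w'] /allpairsPdep[p [v [/allpairsPdep[k [y [_ + ->]]] _ e]]].
case: e => -> -> ->; rewrite mem_letters => /andP[_ /eqP <-].
case/allpairsPdep=> [p' [v' [/allpairsPdep[k' [y' [_ + ->]]] _ e]]].
case: e => -> -> ->; rewrite mem_letters => /andP[_ /eqP <-] /=.
by case=> -> ->.
Qed.

Definition count_words (L : pred word) (n j : nat) : nat := count L (words n j).

(** The left quotient (Brzozowski derivative) of [L] by the letter [x]. *)
Definition residual (L : pred word) (x : letter) : pred word := fun w => L (x :: w).

Lemma count_words_eq L L' n j : word_sub c L L' -> word_sub c L' L ->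
  count_words L n j = count_words L' n j.
Proof.
move=> s s'; apply: eq_in_count => w; rewrite mem_words => /and3P[_ wc _].
by apply/idP/idP; [apply: s|apply: s'].
Qed.

(** Classify words by their first letter. *)
Lemma count_wordsS L n j : count_words L n.+1 j =
  (\sum_(l < j.+1) \sum_(a <- exponents c l) \sum_(b <- [:: false; true])
     count_words (residual L (a, b)) n (j - l))%N.
Proof.
rewrite /count_words wordsS count_flatten sumnE !big_map big_flatten big_map.
rewrite -(big_mkord xpredT (fun l => \sum_(a <- exponents c l)
  \sum_(b <- [:: false; true]) count (residual L (a, b)) (words n (j - l)))%N).
rewrite /index_iota subn0; apply: eq_bigr => l _.
rewrite big_map big_flatten /= big_map; apply: eq_bigr => a _.
by rewrite !big_cons !big_nil /= !count_map.
Qed.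
End Enum.

(** * Rational series with the prescribed denominators *)

(** Congruence modulo the ideal (s^N, t^N).  A power series in s and t is
    handled as a family of polynomials indexed by [N], of which the [N]-th one
    only matters modulo this ideal; identities of series become families of
    congruences between polynomials. *)
Definition cong (N : nat) (p q : {poly {poly int}}) :=
  forall n j, (n < N)%N -> (j < N)%N -> p`_n`_j = q`_n`_j.

Lemma cong_refl N p : cong N p p. Proof. by []. Qed.

Lemma cong_sym N p q : cong N p q -> cong N q p.
Proof. by move=> e n j ltn ltj; rewrite e. Qed.

Lemma cong_trans N q p r : cong N p q -> cong N q r -> cong N p r.
Proof. by move=> e e' n j ltn ltj; rewrite e ?e'. Qed.

Lemma congD N p q p' q' : cong N p q -> cong N p' q' -> cong N (p + p') (q + q').
Proof. by move=> e e' n j ltn ltj; rewrite !coefD e ?e'. Qed.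

Lemma congB N p q p' q' : cong N p q -> cong N p' q' -> cong N (p - p') (q - q').
Proof. by move=> e e' n j ltn ltj; rewrite !coefB e ?e'. Qed.

Lemma congM N p q p' q' : cong N p q -> cong N p' q' -> cong N (p * p') (q * q').
Proof.
move=> e e' n j ltn ltj; rewrite !coefM !coef_sum; apply: eq_bigr => k _.
rewrite !coefM; apply: eq_bigr => l _.
by rewrite e ?e' //; move: (valP k) (valP l) => /= *; lia.
Qed.

Lemma congMl N p q r : cong N p q -> cong N (r * p) (r * q).
Proof. exact: congM. Qed.

Lemma cong_eq N p q : p = q -> cong N p q. Proof. by move->. Qed.

Lemma cong_polyC N (p q : {poly int}) :
  (forall j, (j < N)%N -> p`_j = q`_j) -> cong N p%:P q%:P.
Proof. by move=> e n j _ ltj; rewrite !coefC; case: eqP => // _; rewrite e. Qed.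

Definition denom (a : nat) (ds : seq (nat * {poly int})) : {poly {poly int}} :=
  ((1 - 'X) ^+ a)%:P * \prod_(d <- ds) (((1 - 'X) ^+ d.1)%:P - 'X * d.2%:P).

Lemma denom_cat a a' ds ds' :
  denom (a + a') (ds ++ ds') = denom a ds * denom a' ds'.
Proof. by rewrite /denom big_cat exprD polyCM /=; ring. Qed.

(** The pair (k, f) stands for the factor (1 - t)^k - s f(t). *)
Definition factor_ok (c : nat) (d : nat * {poly int}) :=
  [/\ (d.1 <= c)%N, 0 < d.2.[1] & d.2.[0] = 1].

Definition rational (c : nat) (F : nat -> {poly {poly int}}) :=
  exists a ds g, (forall d, d \in ds -> factor_ok c d) /\
    forall N, cong N (denom a ds * F N) g.

Section Rational.
Variable c : nat.

Lemma rational_ext F G :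
  (forall N, cong N (F N) (G N)) -> rational c F -> rational c G.
Proof.
move=> FG [a [ds [g [dsP H]]]]; exists a, ds, g; split=> // N.
by apply: cong_trans (H N); apply/congMl/cong_sym.
Qed.

Lemma rational_poly g : rational c (fun=> g).
Proof.
exists 0%N, [::], g; split=> // N; rewrite /denom big_nil expr0 mul1r mul1r.
exact: cong_refl.
Qed.

Lemma rationalD F G :
  rational c F -> rational c G -> rational c (fun N => F N + G N).
Proof.
move=> [a [ds [g [dsP H]]]] [a' [ds' [g' [dsP' H']]]].
exists (a + a')%N, (ds ++ ds'), (denom a' ds' * g + denom a ds * g'); split.
  by move=> d; rewrite mem_cat => /orP[/dsP|/dsP'].
move=> N; rewrite denom_cat.
apply: (cong_trans (q := denom a' ds' * (denom a ds * F N)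
                         + denom a ds * (denom a' ds' * G N))).
  by apply: cong_eq; ring.
by apply: congD; apply: congMl.
Qed.

(** The case of interest is b = t^p / (1 - t)^k, the series of a box with [k]
    free coordinates: it only adds powers of 1 - t to the denominator. *)
Lemma rational_geom b k p F : (forall N, cong N (((1 - 'X) ^+ k)%:P * b N) p) ->
  rational c F -> rational c (fun N => b N * F N).
Proof.
move=> bP [a [ds [g [dsP H]]]].
exists (k + a)%N, ds, (p * g); split=> // N.
have -> : denom (k + a) ds = ((1 - 'X) ^+ k)%:P * denom a ds.
  by rewrite /denom exprD polyCM mulrA.
apply: (cong_trans (q := (((1 - 'X) ^+ k)%:P * b N) * (denom a ds * F N))).
  by apply: cong_eq; ring.
exact: congM.
Qed.

Lemma rationalM p F : rational c F -> rational c (fun N => p * F N).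
Proof.
apply: (@rational_geom (fun=> p) 0 p) => N.
by rewrite expr0 mul1r; apply: cong_refl.
Qed.

Lemma rational_sum_in (I : eqType) (r : seq I)
    (F : I -> nat -> {poly {poly int}}) :
  (forall i, i \in r -> rational c (F i)) ->
  rational c (fun N => \sum_(i <- r) F i N).
Proof.
elim: r => [|i r IH] FP.
  by apply: rational_ext (rational_poly 0) => N; rewrite big_nil.
apply: rational_ext (rationalD (FP i _) (IH _)) => [N||j jr]; first by rewrite big_cons.
  exact: mem_head.
by apply: FP; rewrite inE jr orbT.
Qed.

(** Solving F = R + s b F with b = f / (1 - t)^k gives
    ((1 - t)^k - s f) F = (1 - t)^k R.  This is where the factors of the
    denominator come from. *)
Lemma rational_fix F R b k f : factor_ok c (k, f) ->
  (forall N, cong N (((1 - 'X) ^+ k)%:P * b N) f%:P) ->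
  rational c R ->
  (forall N, cong N (F N) (R N + 'X * (b N * F N))) ->
  rational c F.
Proof.
move=> kf bP [a [ds [g [dsP H]]]] FE.
exists a, ((k, f) :: ds), (((1 - 'X) ^+ k)%:P * g); split.
  by move=> d; rewrite inE => /orP[/eqP->|/dsP].
move=> N; set u := ((1 - 'X) ^+ k)%:P.
have -> : denom a ((k, f) :: ds) = (u - 'X * f%:P) * denom a ds.
  by rewrite /denom big_cons /= -/u; ring.
apply: (cong_trans (q := denom a ds * (u * F N) - denom a ds * ('X * (f%:P * F N)))).
  by apply: cong_eq; ring.
apply: (cong_trans (q := denom a ds * (u * (R N + 'X * (b N * F N)))
                         - denom a ds * ('X * (u * b N * F N)))).
  apply: congB; first exact/congMl/congMl/FE.
  by apply/congMl/congMl/congM; [apply/cong_sym/bP | apply: cong_refl].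
apply: (cong_trans (q := u * (denom a ds * R N))); first by apply: cong_eq; ring.
exact: congMl.
Qed.

End Rational.

(** * Rationality of the series of a downset *)

(** Classical truth value, so that sets of words given by propositions can be
    counted. *)
Definition asbool (P : Prop) : bool :=
  if excluded_middle_informative P then true else false.

Lemma asboolP P : reflect P (asbool P).
Proof. by rewrite /asbool; case: excluded_middle_informative => H; constructor. Qed.

Definition nfree (B : seq (nat * bool)) := count (fun x => x.2) B.

Definition box_series (B : seq (nat * bool)) (N : nat) : {poly int} :=
  \poly_(l < N) (count (in_box B) (exponents (size B) l))%:Z.

Lemma coord_series N (x : nat * bool) :
  cong N (((1 - 'X) ^+ x.2)%:P
    * (\poly_(k < N) (if x.2 then (x.1 <= k)%N else k == x.1)%:Z)%:P) ('X^(x.1))%:P.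
Proof.
rewrite -polyCM; apply: cong_polyC => j ltj; case: x => p [] /=.
  rewrite expr1 mulrBl mul1r coefB coefXM !coef_poly ltj coefXn natz.
  case: j ltj => [|j] ltj /=; first by rewrite subr0 leqn0 eq_sym.
  rewrite (ltnW ltj); case: (ltngtP p j.+1) => [lt|lt|->].
  - by rewrite -ltnS lt subrr.
  - by have -> : (p <= j)%N = false by lia.
  - by rewrite ltnn.
by rewrite expr0 mul1r coef_poly ltj coefXn natz.
Qed.

(** A fixed coordinate with value p contributes t^p, a free one with bound p
    contributes t^p + t^(p+1) + ... = t^p / (1 - t). *)
Lemma box_series_geom N B :
  cong N (((1 - 'X) ^+ nfree B)%:P * (box_series B N)%:P) ('X^(sumn (corner B)))%:P.
Proof.
elim: B => [|x B IH].
  rewrite expr0 mul1r; apply: cong_polyC => j ltj.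
  by rewrite coef_poly ltj coefXn; case: j {ltj}.
set G : {poly int} := \poly_(k < N) (if x.2 then (x.1 <= k)%N else k == x.1)%:Z.
have xB : cong N (box_series (x :: B) N)%:P (G%:P * (box_series B N)%:P).
  rewrite -polyCM; apply: cong_polyC => j ltj.
  rewrite coef_poly ltj coefM [size _]/= exponentsS count_flatten sumnE !big_map.
  rewrite -[iota 0 j.+1]/(index_iota 0 j.+1) big_mkord -natz natr_sum.
  apply: eq_bigr => k _; have ltk : (k < N)%N by case: k => k /= H; lia.
  rewrite !coef_poly ltk (leq_ltn_trans (leq_subr _ _) ltj) count_map.
  case E : (if x.2 then _ else _).
    by rewrite mul1r -natz; congr (_%:R); apply: eq_count => a /=; rewrite E.
  rewrite mul0r; apply/eqP; rewrite pnatr_eq0 -leqn0 leqNgt -has_count.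
  by apply/hasPn => a _ /=; rewrite E.
apply: (cong_trans (congMl _ xB)) => {xB}.
apply: (cong_trans (q := (((1 - 'X) ^+ x.2)%:P * G%:P)
    * (((1 - 'X) ^+ nfree B)%:P * (box_series B N)%:P))).
  by apply: cong_eq; rewrite /nfree /= exprD polyCM; ring.
apply: (cong_trans (congM (coord_series x) IH)).
by apply: cong_eq; rewrite /= exprD polyCM.
Qed.

Section Rationality.
Variable c : nat.

Lemma residual_downset L x : letter_in c x -> downset c L -> downset c (residual L x).
Proof.
move=> xc Ld u w wc e; apply: Ld; first by rewrite /= xc.
by apply: emb_cons; rewrite // /letter_le eqxx mon_le_refl.
Qed.

Lemma residual_sub L x : letter_in c x -> downset c L -> word_sub c (residual L x) L.
Proof.
move=> xc Ld w wc; apply: Ld; first by rewrite /= xc.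
exact/emb_skip/emb_refl.
Qed.

Lemma residual_antitone L b : downset c L ->
  antitone c c (fun a => residual L (a, b)).
Proof.
move=> Ld a a' ac aa' w wc; apply: Ld.
  rewrite /= wc andbT; move: aa'; rewrite /mon_le all2E => /andP[/eqP e _].
  by rewrite /letter_in /= -e ac.
by apply: emb_cons; [rewrite /letter_le eqxx|exact: emb_refl].
Qed.

Definition word_series (L : pred word) (N : nat) : {poly {poly int}} :=
  \poly_(n < N) \poly_(j < N) (count_words c L n j)%:Z.

Lemma coef_word_series L N n j : (n < N)%N -> (j < N)%N ->
  (word_series L N)`_n`_j = (count_words c L n j)%:Z.
Proof. by move=> ltn ltj; rewrite !coef_poly ltn coef_poly ltj. Qed.

(** Each exponent vector lies in exactly one box, on which the summand is
    constant. *)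
Lemma sum_box (bs : seq (seq (nat * bool))) (S : seq nat -> nat) j :
  (forall B, B \in bs -> size B = c) ->
  (forall a, size a = c -> count (in_box ^~ a) bs = 1%N) ->
  (forall B a, B \in bs -> size a = c -> in_box B a -> S a = S (corner B)) ->
  (\sum_(a <- exponents c j) S a =
   \sum_(B <- bs) count (in_box B) (exponents c j) * S (corner B))%N.
Proof.
move=> bsz bs1 bsS.
have -> : (\sum_(a <- exponents c j) S a =
    \sum_(a <- exponents c j) \sum_(B <- bs | in_box B a) S (corner B))%N.
  rewrite !(big_seq _ _ (exponents c j)); apply: eq_bigr => a.
  rewrite mem_exponents => /andP[/eqP ac _].
  rewrite -[LHS]mul1n -(bs1 a ac) -sum1_count big_distrl /=.
  rewrite big_seq_cond [RHS]big_seq_cond; apply: eq_bigr => B /andP[Bbs Ba].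
  by rewrite mul1n; apply: bsS.
rewrite (exchange_big_dep xpredT) //=; apply: eq_bigr => B _.
by rewrite -sum1_count big_distrl /=; apply: eq_bigr => a _; rewrite mul1n.
Qed.

(** A nonempty word of [L] is a letter followed by a word of the residual, and
    the residual only depends on the mark of the letter and on the box of its
    exponent vector. *)
Lemma word_series_step L N (bs : bool -> seq (seq (nat * bool))) :
  downset c L ->
  (forall b, [/\ forall B, B \in bs b -> size B = c,
        forall a, size a = c -> count (in_box ^~ a) (bs b) = 1%N
      & forall B a, B \in bs b -> in_box B a ->
          word_sub c (residual L (corner B, b)) (residual L (a, b)) /\
          word_sub c (residual L (a, b)) (residual L (corner B, b))]) ->
  cong N (word_series L N)
    ((L [::])%:R + \sum_(b <- [:: false; true]) \sum_(B <- bs b)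
       'X * ((box_series B N)%:P * word_series (residual L (corner B, b)) N)).
Proof.
move=> Ld bsP [|n] j ltn ltj; rewrite coef_word_series // !coefD !coef_sum.
  rewrite [X in _ + X]big1 => [|b _]; last first.
    rewrite coef_sum big1 ?coef0 // => B _; by rewrite coefXM.
  rewrite addr0 -polyC_natr coefC /= -polyC_natr coefC.
  by rewrite /count_words; case: j {ltj} => //=; rewrite addn0 natz.
rewrite -polyC_natr coefC /= coef0 add0r count_wordsS.
have -> : (\sum_(l < j.+1) \sum_(a <- exponents c l) \sum_(b <- [:: false; true])
     count_words c (residual L (a, b)) n (j - l) = \sum_(b <- [:: false; true])
     \sum_(B <- bs b) \sum_(l < j.+1) count (in_box B) (exponents c l) *
       count_words c (residual L (corner B, b)) n (j - l))%N.
  transitivity (\sum_(b <- [:: false; true]) \sum_(l < j.+1)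
      \sum_(a <- exponents c l) count_words c (residual L (a, b)) n (j - l))%N.
    rewrite exchange_big /=; apply: eq_bigr => l _.
    by rewrite exchange_big.
  apply: eq_bigr => b _; rewrite exchange_big /=; apply: eq_bigr => l _.
  have [bsz bs1 bsS] := bsP b.
  apply: (@sum_box _ (fun a => count_words c (residual L (a, b)) n (j - l))) => //.
  by move=> B a Bbs _ Ba; have [s s'] := bsS B a Bbs Ba; apply: count_words_eq.
rewrite -natz natr_sum; apply: eq_bigr => b _.
have [bsz _ _] := bsP b.
rewrite natr_sum !coef_sum big_seq [RHS]big_seq; apply: eq_bigr => B Bbs.
rewrite coefXM /= coefCM coefM natr_sum; apply: eq_bigr => l _.
have ltl : (l < N)%N by case: l => l /= H; lia.
rewrite coef_word_series ?(ltnW ltn) // ?(leq_ltn_trans (leq_subr _ _) ltj) //.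
by rewrite coef_poly ltl bsz // natrM !natz.
Qed.

Lemma nfree_le B : (nfree B <= size B)%N. Proof. exact: count_size. Qed.

Lemma in_box_zero B : in_box B (nseq (size B) 0%N) = (sumn (corner B) == 0%N).
Proof.
by elim: B => //= [[p []] B] ->; rewrite addn_eq0 //= ?leqn0 // eq_sym.
Qed.

Lemma corner_zero B : sumn (corner B) = 0%N -> corner B = nseq (size B) 0%N.
Proof.
elim: B => //= [[p b] B] IH /eqP.
by rewrite addn_eq0 /= => /andP[/eqP-> /eqP/IH->].
Qed.

Lemma mon_le_zero a : mon_le (nseq (size a) 0%N) a.
Proof. by elim: a. Qed.

Lemma max_exists (T : eqType) (F : T -> nat) (s : seq T) : s != [::] ->
  exists2 x, x \in s & forall y, y \in s -> (F y <= F x)%N.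
Proof.
elim: s => [//|x s IH] _; have [->|/IH[y ys Hy]] := eqVneq s [::].
  by exists x; rewrite ?mem_head // => y; rewrite inE => /eqP->.
case: (leqP (F y) (F x)) => [le|lt]; [exists x|exists y].
- exact: mem_head.
- by move=> z; rewrite inE => /orP[/eqP->//|/Hy H]; apply: leq_trans le.
- by rewrite inE ys orbT.
- by move=> z; rewrite inE => /orP[/eqP->|/Hy//]; apply: ltnW.
Qed.

(** Induction on the downset.  The residuals of [L] are contained in [L];
    those strictly smaller are rational by induction, and the boxes [D] with
    residual [L] turn the first-letter recursion into a fixed point equation
    for the series of [L].  With [k] the maximal number of free coordinates of
    a box in [D], the series of these boxes is f / (1 - t)^k, where f is the
    sum of t^|corner| (1 - t)^(k - free).  Then f(1) counts the boxes attaining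
    the maximum, and f(0) counts those with corner 0, which is one: the zero
    vector has the largest residual.  The bound on the marks keeps marked
    letters out of [D], since a marked letter with residual [L] could be
    prepended indefinitely. *)
Theorem downset_rational d L : downset c L ->
  (forall w, word_in c w -> L w -> (count (fun x => x.2) w <= d)%N) ->
  rational c (word_series L).
Proof.
move=> Ld; move: L Ld; apply: downset_ind => L Ld IH Lbd.
have IHx x : letter_in c x -> ~ word_sub c L (residual L x) ->
    rational c (word_series (residual L x)).
  move=> xc ns; apply: IH => //; [exact: residual_downset|exact: residual_sub|].
  by move=> w wc Lw; apply: Lbd => //; apply: residual_sub Lw.
case: (classic (exists2 w, word_in c w & L w)) => [[w0 w0c Lw0]|Lempty]; last first.
  apply: rational_ext (rational_poly c 0) => N n j ltn ltj.
  rewrite coef_word_series // !coef0 /count_words.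
  suff -> : count L (words c n j) = 0%N by [].
  apply/eqP; rewrite -leqn0 leqNgt -has_count; apply/hasPn => w.
  by rewrite mem_words => /and3P[_ wc _]; apply/negP => Lw; apply: Lempty; exists w.
(* prepending the marked letter repeatedly exceeds the bound on the marks *)
have marked a : size a = c -> ~ word_sub c L (residual L (a, true)).
  move=> ac s; suff H k : L (nseq k (a, true) ++ w0) /\
      word_in c (nseq k (a, true) ++ w0).
    have [Lw wc] := H d.+1; have := Lbd _ wc Lw.
    by rewrite count_cat count_nseq mul1n; lia.
  elim: k => [|k [Lk wk]] //; split; first exact: s.
  by rewrite /= wk /letter_in /= ac eqxx.
have /ClassicalEpsilon.choice[bs bsP] : forall b, exists bs : seq (seq (nat * bool)),
    [/\ forall B, B \in bs -> size B = c,
        forall a, size a = c -> count (in_box ^~ a) bs = 1%N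
      & forall B a, B \in bs -> in_box B a ->
          word_sub c (residual L (corner B, b)) (residual L (a, b)) /\
          word_sub c (residual L (a, b)) (residual L (corner B, b))].
  move=> b; apply: box_partition; last exact: residual_antitone.
  by move=> a ac; apply: residual_downset; rewrite // /letter_in ac.
have szB b B : B \in bs b -> letter_in c (corner B, b).
  by move=> Bbs; rewrite /letter_in size_map; have [-> //] := bsP b.
pose stable B := asbool (word_sub c L (residual L (corner B, false))).
pose D := [seq B <- bs false | stable B].
pose term b B N :=
  'X * ((box_series B N)%:P * word_series (residual L (corner B, b)) N).
have term_rat b B : letter_in c (corner B, b) ->
    ~ word_sub c L (residual L (corner B, b)) -> rational c (term b B).
  move=> Bc ns; apply: rationalM; apply: rational_geom (IHx _ Bc ns) => N.
  exact: box_series_geom.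
pose R N := (L [::])%:R + (\sum_(B <- bs true) term true B N +
  \sum_(B <- bs false | ~~ stable B) term false B N).
have R_rat : rational c R.
  apply: (@rationalD _ (fun=> (L [::])%:R)); first exact: rational_poly.
  apply: rationalD.
    apply: rational_sum_in => B Bbs; apply: term_rat; first exact: szB.
    by apply: marked; apply/eqP/(szB true).
  apply: (@rational_ext _
    (fun N => \sum_(B <- [seq B <- bs false | ~~ stable B]) term false B N)).
    by move=> N; rewrite big_filter.
  apply: rational_sum_in => B; rewrite mem_filter => /andP[/asboolP ns Bbs].
  by apply: term_rat => //; apply: szB.
pose b N := \sum_(B <- D) (box_series B N)%:P : {poly {poly int}}.
have rec N : cong N (word_series L N) (R N + 'X * (b N * word_series L N)).
  apply: (cong_trans (word_series_step Ld bsP)).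
  rewrite 2!big_cons big_nil addr0 /R -[X in cong _ _ X]addrA.
  apply: congD => //; rewrite [X in cong _ X]addrC -[X in cong _ _ X]addrA.
  apply: congD => //; rewrite (bigID stable) /= addrC; apply: congD => //.
  rewrite /b mulr_suml mulr_sumr /D big_filter => n j ltn ltj.
  rewrite !coef_sum big_seq_cond [RHS]big_seq_cond.
  apply: eq_bigr => B /andP[Bbs /asboolP s].
  move: n j ltn ltj; apply: congMl; apply: congMl => n j ltn ltj.
  rewrite !coef_word_series //; congr Posz; apply: count_words_eq => //.
  by apply: residual_sub => //; apply: szB.
have [D0|Dn0] := eqVneq D [::].
  apply: rational_ext R_rat => N; apply: cong_sym; apply: (cong_trans (rec N)).
  by rewrite /b D0 big_nil mul0r mulr0 addr0.
have [B0 B0D B0max] := max_exists nfree Dn0.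
pose k := nfree B0.
pose f : {poly int} := \sum_(B <- D) (1 - 'X) ^+ (k - nfree B) * 'X^(sumn (corner B)).
have DB B : B \in D -> [/\ B \in bs false, size B = c & stable B].
  by rewrite mem_filter => /andP[sB Bbs]; split=> //; have [->] := bsP false.
apply: (rational_fix (b := b) (k := k) (f := f) _ _ R_rat rec); last first.
  move=> N; rewrite /b /f mulr_sumr.
  have -> : (\sum_(B <- D) (1 - 'X) ^+ (k - nfree B) * 'X^(sumn (corner B)))%:P
     = \sum_(B <- D) ((1 - 'X) ^+ (k - nfree B))%:P * ('X^(sumn (corner B)))%:P
     :> {poly {poly int}}.
    by rewrite rmorph_sum; apply: eq_bigr => B _; rewrite rmorphM.
  move=> n j ltn ltj; rewrite !coef_sum big_seq [RHS]big_seq.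
  apply: eq_bigr => B /B0max le.
  rewrite -{1}(subnK le : (k - nfree B + nfree B = k)%N) exprD polyCM -mulrA.
  exact: congMl (@box_series_geom N B) n j ltn ltj.
split=> /=.
- by have [_ <- _] := DB _ B0D; apply: nfree_le.
- rewrite /f horner_sum (eq_bigr (fun B => ((k - nfree B)%N == 0%N)%:R)); last first.
    by move=> B _; rewrite hornerM horner_exp !hornerE expr1n mulr1 subrr expr0n.
  by rewrite -natr_sum ltr0n (big_rem B0 B0D) /= subnn.
- rewrite /f horner_sum.
  transitivity (\sum_(B <- bs false) (in_box B (nseq c 0%N))%:R : int).
    rewrite /D big_filter big_mkcond /=; rewrite big_seq [RHS]big_seq.
    apply: eq_bigr => B Bbs; have [szB' _ _] := bsP false.
    rewrite hornerM horner_exp !hornerE expr1n mul1r expr0n.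
    rewrite -(szB' B Bbs) in_box_zero; case: eqP => [e|]; last by case: ifP.
    rewrite ifT //; apply/asboolP.
    move: B0D; rewrite mem_filter => /andP[/asboolP s B0bs] w wc Lw.
    rewrite (corner_zero e) (szB' B Bbs).
    have zB0 : mon_le (nseq c 0%N) (corner B0).
      by rewrite -[c](eqP (szB _ _ B0bs)) mon_le_zero.
    by apply: (residual_antitone Ld (size_nseq c _) zB0) => //; apply: s.
  have [_ /(_ (nseq c 0%N) (size_nseq _ _)) bs1 _] := bsP false.
  rewrite -natr_sum -[RHS]/(1%:R); congr (_%:R); apply: etrans bs1.
  by rewrite -sum1_count [RHS]big_mkcond; apply: eq_bigr => B _; case: ifP.
Qed.
End Rationality.

(** * Bases selected by a total order *)

Section LinearSpan.
Variables (K : fieldType) (r : nat) (U : lmodType {mpoly K[r]}).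
Implicit Types (xs : seq U) (q : U).

(** The K-subspace spanned by a list of vectors, built by peeling off one
    vector at a time so that dimensions can be computed by recursion on the
    list. *)
Fixpoint kspan xs q : Prop :=
  if xs is x :: xs' then exists a : K, kspan xs' (q - a%:MP *: x) else q = 0.

Lemma kspan0 xs : kspan xs 0.
Proof. by elim: xs => //= x xs IH; exists 0; rewrite scale0r subr0. Qed.

Lemma kspanD xs q q' : kspan xs q -> kspan xs q' -> kspan xs (q + q').
Proof.
elim: xs q q' => [|x xs IH] q q' /=; first by move=> -> ->; rewrite addr0.
move=> [a qa] [a' qa']; exists (a + a'); rewrite mpolyCD scalerDl opprD addrACA.
exact: IH.
Qed.

Lemma kspanZ xs (b : K) q : kspan xs q -> kspan xs (b%:MP *: q).
Proof.
elim: xs q => [|x xs IH] q /=; first by move->; rewrite scaler0.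
by move=> [a /IH H]; exists (b * a); rewrite mpolyCM -scalerA -scalerBr.
Qed.

Lemma kspan_mem xs x : x \in xs -> kspan xs x.
Proof.
elim: xs => //= y xs IH; rewrite inE => /orP[/eqP->|/IH H].
  by exists 1; rewrite scale1r subrr; apply: kspan0.
by exists 0; rewrite scale0r subr0.
Qed.

Fixpoint independent_count xs : nat :=
  if xs is x :: xs' then independent_count xs' + ~~ asbool (kspan xs' x) else 0.

Lemma has_dim_ext (V V' : U -> Prop) d :
  (forall q, V q <-> V' q) -> has_dim V d -> has_dim V' d.
Proof.
move=> VV' [v [Vv vgen vfree]]; exists v; split=> // [i|q /VV'/vgen//].
exact/VV'.
Qed.

Lemma kspan_sum xs (I : Type) (s : seq I) (F : I -> U) :
  (forall i, kspan xs (F i)) -> kspan xs (\sum_(i <- s) F i).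
Proof.
by move=> FP; elim/big_ind: _ => //; [apply: kspan0|move=> *; apply: kspanD].
Qed.

Lemma has_dim_kspan_cons xs x d : has_dim (kspan xs) d ->
  has_dim (kspan (x :: xs)) (d + ~~ asbool (kspan xs x)).
Proof.
case: asboolP => [xin|xnin] /=.
  rewrite addn0; apply: has_dim_ext => q; split=> [qs|[a H]].
    by exists 0; rewrite scale0r subr0.
  by rewrite -[q](subrK (a%:MP *: x)); apply: kspanD => //; apply: kspanZ.
move=> [v [Vv vgen vfree]]; rewrite addn1.
pose v' (i : 'I_d.+1) := if unlift ord0 i is Some k then v k else x.
have v'0 : v' ord0 = x by rewrite /v' unlift_none.
have v'S k : v' (lift ord0 k) = v k by rewrite /v' liftK.
have spanv (a : 'I_d -> K) : kspan xs (\sum_i (a i)%:MP *: v i).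
  by apply: kspan_sum => i; apply: kspanZ.
exists v'; split=> [i|q [a /vgen[b qb]]|a].
- case: (unliftP ord0 i) => [k|] ->; rewrite ?v'0 ?v'S.
    by exists 0; rewrite scale0r subr0.
  by exists 1; rewrite scale1r subrr; apply: kspan0.
- exists (fun i => if unlift ord0 i is Some k then b k else a).
  rewrite big_ord_recl v'0 unlift_none -[LHS](subrK (a%:MP *: x)) qb addrC.
  by congr (_ + _); apply: eq_bigr => k _; rewrite v'S liftK.
rewrite big_ord_recl v'0.
rewrite (eq_bigr (fun k => (a (lift ord0 k))%:MP *: v k)); last first.
  by move=> k _; rewrite v'S.
have [a0|a0] := eqVneq (a ord0) 0.
  rewrite a0 scale0r add0r => /vfree aS i.
  by case: (unliftP ord0 i) => [k|] ->.
move/eqP; rewrite addr_eq0 => /eqP e; case: xnin.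
have -> : x = (- (a ord0)^-1)%:MP *: \sum_k (a (lift ord0 k))%:MP *: v k.
  by rewrite mpolyCN scaleNr -scalerN -e scalerA -mpolyCM mulVf // scale1r.
exact/kspanZ/spanv.
Qed.

Lemma has_dim_kspan_nil : has_dim (kspan [::]) 0.
Proof.
exists (fun=> 0); split=> [i|q /= ->|a _ []//]; first by case: i.
by exists (fun=> 0); rewrite big_ord0.
Qed.

Lemma has_dim_kspan xs : has_dim (kspan xs) (independent_count xs).
Proof.
elim: xs => [|x xs IH]; first exact: has_dim_kspan_nil.
exact: has_dim_kspan_cons.
Qed.

End LinearSpan.

Lemma kspan_map (K : fieldType) (r r' : nat) (U : lmodType {mpoly K[r]})
    (U' : lmodType {mpoly K[r']}) (op : U -> U') xs ys :
  {morph op : x y / x + y} -> (forall (a : K) q, op (a%:MP *: q) = a%:MP *: op q) ->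
  (forall x, x \in xs -> kspan ys (op x)) ->
  forall q, kspan xs q -> kspan ys (op q).
Proof.
move=> opD opZ; elim: xs => [|x xs IH] xsP q /=.
  by move=> ->; rewrite -[0](scale0r 0) -mpolyC0 opZ mpolyC0 scale0r; apply: kspan0.
move=> [a H]; rewrite -[q](subrK (a%:MP *: x)) opD opZ; apply: kspanD.
  by apply: IH H => y yxs; apply: xsP; rewrite inE yxs orbT.
by apply/kspanZ/xsP/mem_head.
Qed.

Lemma kspan_sub (K : fieldType) (r : nat) (U : lmodType {mpoly K[r]})
    (xs ys : seq U) q :
  (forall x, x \in xs -> kspan ys x) -> kspan xs q -> kspan ys q.
Proof. by move=> H; apply: (kspan_map (op := id)). Qed.

Section PredSpan.
Variables (K : fieldType).

Inductive pspan (r : nat) (U : lmodType {mpoly K[r]}) (S : U -> Prop) : U -> Prop :=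
| pspan0 : pspan S 0
| pspan_cons (a : K) x q : S x -> pspan S q -> pspan S (a%:MP *: x + q).

Lemma pspanD r (U : lmodType {mpoly K[r]}) (S : U -> Prop) x y :
  pspan S x -> pspan S y -> pspan S (x + y).
Proof.
move=> Sx Sy; elim: Sx => [|a z q Sz _ IH]; first by rewrite add0r.
by rewrite -addrA; apply: pspan_cons.
Qed.

Lemma pspan_mem r (U : lmodType {mpoly K[r]}) (S : U -> Prop) x : S x -> pspan S x.
Proof.
by move=> Sx; have := pspan_cons 1 Sx (pspan0 S); rewrite scale1r addr0.
Qed.

Lemma pspan_map r r' (U : lmodType {mpoly K[r]}) (U' : lmodType {mpoly K[r']})
    (op : U -> U') (S : U -> Prop) (S' : U' -> Prop) :
  {morph op : x y / x + y} -> (forall (a : K) q, op (a%:MP *: q) = a%:MP *: op q) ->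
  (forall x, S x -> S' (op x)) -> forall q, pspan S q -> pspan S' (op q).
Proof.
move=> opD opZ opS q; elim=> [|a x {}q Sx _ IH].
  by rewrite -[0](scale0r 0) -mpolyC0 opZ mpolyC0 scale0r; apply: pspan0.
by rewrite opD opZ; apply: pspan_cons => //; apply: opS.
Qed.

Lemma pspanZ r (U : lmodType {mpoly K[r]}) (S : U -> Prop) (a : K) q :
  pspan S q -> pspan S (a%:MP *: q).
Proof.
elim=> [|b x {}q Sx _ IH]; first by rewrite scaler0; apply: pspan0.
by rewrite scalerDr scalerA -mpolyCM; apply: pspan_cons.
Qed.

Lemma pspan_kspan r (U : lmodType {mpoly K[r]}) (S : U -> Prop) xs q :
  (forall x, S x -> kspan xs x) -> pspan S q -> kspan xs q.
Proof.
move=> H; elim=> [|a x {}q Sx _ IH]; first exact: kspan0.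
by apply: kspanD => //; apply/kspanZ/H.
Qed.
End PredSpan.

Section OrderedSpan.
Variables (K : fieldType) (r : nat) (U : lmodType {mpoly K[r]}).
Variables (T : eqType) (disp : Order.disp_t) (O : orderType disp).
Variables (key : T -> O) (v : T -> U).
Hypothesis key_inj : injective key.

Definition smaller (s : seq T) x := [seq y <- s | (key y < key x)%O].
(** The standard elements are those kept by the greedy choice of a basis of the
    span that runs through [s] in increasing order. *)
Definition standard (s : seq T) x := ~~ asbool (kspan (map v (smaller s x)) (v x)).

Lemma standard_eqi s s' x : s =i s' -> standard s x = standard s' x.
Proof.
move=> ss'; rewrite /standard; congr negb.
apply/asboolP/asboolP; apply: kspan_sub => _ /mapP[y + ->];
  rewrite mem_filter ?ss' -?ss' => H; apply/kspan_mem/map_f;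
  by rewrite mem_filter ?ss' // -?ss'.
Qed.

(** In a decreasing list the tail of an element consists of the elements of
    the list that are smaller than it. *)
Lemma independent_count_sorted s : sorted (fun x y => key y < key x)%O s ->
  independent_count (map v s) = count (standard s) s.
Proof.
elim: s => //= x s IH; rewrite path_sortedE; last first.
  by move=> a b d /= ab bd; apply: lt_trans ab.
move=> /andP[/allP xs ss]; rewrite (IH ss) addnC; congr (_ + _)%N.
  rewrite /standard /smaller /= ltxx; congr (~~ asbool (kspan (map v _) _)).
  by symmetry; apply/all_filterP/allP.
apply: eq_in_count => y ys; rewrite /standard /smaller /=.
by rewrite ltNge le_eqVlt (xs y ys) orbT.
Qed.

Lemma has_dim_standard s : uniq s ->
  has_dim (kspan (map v s)) (count (standard s) s).
Proof.
move=> us; pose s' := rev (sort (relpre key <=%O) s).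
have ps : perm_eq s' s by rewrite perm_rev perm_sort.
have ss' : sorted (fun x y => key y < key x)%O s'.
  rewrite rev_sorted -[sorted _ _]/(sorted (relpre key <%O) _) -sorted_map.
  rewrite -sort_map sort_lt_sorted.
  by rewrite map_inj_uniq.
have <- : count (standard s') s' = count (standard s) s.
  rewrite (permP ps); apply: eq_count => x; apply: standard_eqi; exact: perm_mem.
rewrite -independent_count_sorted //.
apply: has_dim_ext (has_dim_kspan _) => q.
by split; apply: kspan_sub => _ /mapP[x xs ->]; apply/kspan_mem/map_f;
  rewrite ?(perm_mem ps) // -(perm_mem ps).
Qed.
End OrderedSpan.

(** * The lexicographic order on words *)

(** The lexicographic order read off at the first difference, a form that
    carries over to words of another length. *)
Lemma ltxi_nthP (disp : Order.disp_t) (T : orderType disp) (x0 : T)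
    (s t : seqlexi T) : size s = size t ->
  (s < t)%O <-> exists2 p, (p < size s)%N &
    (forall q, (q < p)%N -> nth x0 s q = nth x0 t q) /\ (nth x0 s p < nth x0 t p)%O.
Proof.
elim: s t => [|x s IH] [|y t] //=.
  by split; [rewrite ltxx|case].
move=> [/IH{}IH].
rewrite ltxi_cons; split.
  case/andP=> lexy /implyP H; have [ltxy|leyx] := ltP x y.
    by exists 0%N.
  have [p ps [H1 H2]] := (IH.1 (H leyx)); exists p.+1 => //; split=> //.
  case=> [_|q]; last exact: H1.
  by apply/eqP; rewrite eq_le lexy.
case=> -[|p] ps [H1 H2].
  by rewrite /= in H2; rewrite (ltW H2) leNgt H2.
have := H1 0%N isT => /= ->; rewrite lexx /=.
by apply/IH; exists p => //; split=> // q qp; apply: (H1 q.+1).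
Qed.

Notation letter0 := (([::], false) : letter).

Definition entry (w : word) (i j : nat) : nat := nth 0%N (nth letter0 w j).1 i.
Definition mark (w : word) (j : nat) : bool := (nth letter0 w j).2.

Definition letter_key (x : letter) : seqlexi nat := (x.2 : nat) :: x.1.
(** Words are compared lexicographically, letter by letter, and letters again
    lexicographically, with the mark in front.  Any total order on words would
    do that is strictly preserved by inserting a letter at a given place and by
    adding exponents there. *)
Definition word_key (w : word) : seqlexi (seqlexi nat) := [seq letter_key x | x <- w].

Lemma word_key_inj : injective word_key.
Proof.
apply: inj_map => [[a b] [a' b']] [e ->]; congr (_, _).
by case: b b' e => [] [].
Qed.

Lemma letter_lt_key c x y : letter_in c x -> letter_in c y ->
  (letter_key x < letter_key y)%O <->
  (x.2 < y.2)%N \/ x.2 = y.2 /\ exists2 i, (i < c)%N &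
    (forall k, (k < i)%N -> nth 0%N x.1 k = nth 0%N y.1 k) /\
    (nth 0%N x.1 i < nth 0%N y.1 i)%N.
Proof.
move=> /eqP xc /eqP yc.
have sz : size (letter_key x) = size (letter_key y) by rewrite /= xc yc.
split=> [/(ltxi_nthP (0%N : nat) sz)|].
  case=> -[|i] /= lti [H1 H2]; first by left.
  right; split; first by have := H1 0%N isT => /=; case: (x.2); case: (y.2).
  by exists i; rewrite -?xc //; split=> // k; apply: (H1 k.+1).
case=> [lt|[e [i ic [H1 H2]]]]; apply/(ltxi_nthP (0%N : nat) sz).
  by exists 0%N.
exists i.+1; first by rewrite /= xc.
by split=> // -[|k] //=; [rewrite e|apply: H1].
Qed.

Lemma word_lt_key c n u w : size u = n -> size w = n -> word_in c u -> word_in c w ->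
  (word_key u < word_key w)%O <-> exists2 p, (p < n)%N &
    (forall q, (q < p)%N -> nth letter0 u q = nth letter0 w q) /\
    (letter_key (nth letter0 u p) < letter_key (nth letter0 w p))%O.
Proof.
move=> un wn uc wc.
have sz : size (word_key u) = size (word_key w) by rewrite !size_map un wn.
have key_inj : injective letter_key.
  by move=> [a b] [a' b'] [e ->]; congr (_, _); case: b b' e => [] [].
split=> [/(ltxi_nthP (letter_key letter0) sz)|[p pn [H1 H2]]].
  case=> p; rewrite size_map un => pn [H1 H2]; exists p => //; split.
    move=> q qp; have qn := ltn_trans qp pn; have := H1 q qp.
    by rewrite !(nth_map letter0) ?un ?wn // => /key_inj.
  by rewrite !(nth_map letter0) ?un ?wn // in H2.
apply/(ltxi_nthP (letter_key letter0) sz); exists p; first by rewrite size_map un.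
split=> [q qp|]; last by rewrite !(nth_map letter0) ?un ?wn.
have qn := ltn_trans qp pn.
by rewrite !(nth_map letter0) ?un ?wn // H1.
Qed.

Definition nmarks (w : word) := count (fun x => x.2) w.

Lemma emb_nmarks u w : emb u w -> (nmarks u <= nmarks w)%N.
Proof.
elim=> [//|x {}u {}w _ IH|x y {}u {}w /andP[/eqP e _] _ IH] /=.
  exact: leq_trans (leq_addl _ _).
by rewrite e leq_add2l.
Qed.

(** With equal numbers of marks no marked letter can be skipped, because the
    marks of [u] already account for all marks of [w]. *)
Lemma emb_increasing u w : emb u w -> nmarks u = nmarks w ->
  exists f : nat -> nat, [/\ {homo f : i j / (i < j)%N},
    forall j, (j < size u)%N -> (f j < size w)%N,
    forall j, (j < size u)%N -> letter_le (nth letter0 u j) (nth letter0 w (f j))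
  & forall q, (q < size w)%N -> (forall j, (j < size u)%N -> f j <> q) ->
      mark w q = false].
Proof.
elim=> [{}w|x {}u {}w e IH|x y {}u {}w xy e IH] /= m.
- exists id; split=> // q qw _; apply/negP => mq.
  have : has (fun x : letter => x.2) w.
    by apply/hasP; exists (nth letter0 w q); rewrite ?mem_nth.
  by rewrite has_count -/(nmarks w) -m.
- have uw := emb_nmarks e.
  have [x0 m'] : x.2 = false /\ nmarks u = nmarks w.
    by move: m uw; rewrite /nmarks /=; case: (x.2) => /=; lia.
  have [f [fi fs fle fm]] := IH m'.
  exists (fun j => (f j).+1); split=> //.
  case=> [_ _|q]; [exact: x0|rewrite ltnS => qw H].
    by apply: fm => // j /H jq fj; apply: jq; rewrite fj.
- have [|f [fi fs fle fm]] := IH.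
    by case/andP: (xy) => /eqP e' _; move: m; rewrite /nmarks /= e' => /addnI.
  exists (fun j => if j is j'.+1 then (f j').+1 else 0%N); split.
  + by case=> [|i] [|j] // ij; rewrite /= ltnS; apply: fi.
  + by case=> [|j] // ju; rewrite /= ltnS; apply: fs.
  + by case=> [|j] //; apply: fle.
  + case=> [_ /(_ 0%N)|q qw H]; first by case.
    by apply: fm => // j ju fj; apply: (H j.+1) => //; rewrite fj.
Qed.

(** * Stretching words along increasing maps *)

(** Words and their transformations are described by the matrix of exponents
    (variable [i], column [j]) and the list of marks. *)
Definition table (c n : nat) (e : nat -> nat -> nat) (m : nat -> bool) : word :=
  mkseq (fun j => (mkseq (e ^~ j) c, m j)) n.

Lemma entry_table c n e m i j : (i < c)%N -> (j < n)%N ->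
  entry (table c n e m) i j = e i j.
Proof. by move=> ic jn; rewrite /entry nth_mkseq //= nth_mkseq. Qed.

Lemma mark_table c n e m j : (j < n)%N -> mark (table c n e m) j = m j.
Proof. by move=> jn; rewrite /mark nth_mkseq. Qed.

Lemma table_in c n e m : word_in c (table c n e m).
Proof. by apply/allP => _ /mapP[j _ ->]; rewrite /letter_in size_mkseq. Qed.

Lemma size_table c n e m : size (table c n e m) = n.
Proof. exact: size_mkseq. Qed.

Lemma letter_entries c w j : word_in c w -> (j < size w)%N ->
  nth letter0 w j = (mkseq (entry w ^~ j) c, mark w j).
Proof.
move=> wc jw; have /(all_nthP letter0)/(_ j jw)/eqP sz := wc.
by rewrite /mark /entry -sz mkseq_nth; case: (nth letter0 w j).
Qed.

Lemma word_table c w : word_in c w -> table c (size w) (entry w) (mark w) = w.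
Proof.
move=> wc; apply: (@eq_from_nth _ letter0); first exact: size_mkseq.
by move=> j; rewrite size_mkseq => jw; rewrite nth_mkseq // (letter_entries wc).
Qed.

Lemma eq_word c w w' : size w = size w' -> word_in c w -> word_in c w' ->
  (forall i j, (i < c)%N -> (j < size w)%N -> entry w i j = entry w' i j) ->
  (forall j, (j < size w)%N -> mark w j = mark w' j) -> w = w'.
Proof.
move=> sz wc wc' ew mw; apply: (@eq_from_nth _ letter0) => // j jw.
rewrite (letter_entries wc) // (letter_entries wc') -?sz // mw //.
congr (_, _); apply: (@eq_from_nth _ 0%N); rewrite !size_mkseq // => i ic.
by rewrite !nth_mkseq // ew.
Qed.

Lemma entry_default w i j : (size w <= j)%N -> entry w i j = 0%N.
Proof. by move=> jw; rewrite /entry (nth_default letter0) // nth_nil. Qed.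

Lemma mark_default w j : (size w <= j)%N -> mark w j = false.
Proof. by move=> jw; rewrite /mark nth_default. Qed.

Lemma wdeg_entries c w : word_in c w ->
  wdeg w = (\sum_(j < size w) \sum_(i < c) entry w i j)%N.
Proof.
move=> wc; rewrite -{1}(word_table wc) /wdeg sumnE !big_map.
rewrite -[X in iota 0 X]subn0 big_mkord; apply: eq_bigr => j _ /=.
by rewrite sumnE big_map -[X in iota 0 X]subn0 big_mkord.
Qed.

Section Stretch.
Variables (c n n' : nat) (f : nat -> nat).
Hypothesis f_incr : {homo f : i j / (i < j)%N}.
Hypothesis f_lt : forall j, (j < n)%N -> (f j < n')%N.

(** The preimage of [q] under [f] among the indices below [n], and [n] itself
    when there is none.  Position [n] is out of range for a word of length [n],
    where exponents read 0 and marks read false: columns outside the image of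
    [f] then need no separate treatment. *)
Definition preindex q := index q [seq f p | p <- iota 0 n].

Lemma f_inj : injective f.
Proof. by move=> i j e; case: (ltngtP i j) => // /f_incr; rewrite e ltnn. Qed.

Lemma preindexK p : (p < n)%N -> preindex (f p) = p.
Proof.
move=> pn; rewrite /preindex index_map; last exact: f_inj.
by rewrite -[X in index X]add0n -(nth_iota 0 0 pn) index_uniq ?iota_uniq ?size_iota.
Qed.

Lemma preindex_lt q : (preindex q < n)%N -> f (preindex q) = q.
Proof.
move=> H; have : q \in [seq f p | p <- iota 0 n].
  by rewrite -index_mem size_map size_iota.
by case/mapP=> p; rewrite mem_iota add0n => pn ->; rewrite preindexK.
Qed.

Lemma preindex_le q : (preindex q <= n)%N.
Proof.
by have := index_size q [seq f p | p <- iota 0 n]; rewrite size_map size_iota.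
Qed.

Lemma big_preindex (R : Type) (idx : R) (op : Monoid.com_law idx) (G : nat -> R) :
  G n = idx ->
  \big[op/idx]_(q < n') G (preindex q) = \big[op/idx]_(p < n) G p.
Proof.
move=> Gn; rewrite -(big_mkord xpredT (fun q => G (preindex q))) -(big_mkord xpredT).
rewrite (bigID (fun q => preindex q < n)%N) /=.
rewrite [X in op _ X]big1 ?Monoid.mulm1; last first.
  move=> q; rewrite -leqNgt => le; rewrite -Gn; congr G.
  by apply/eqP; rewrite eqn_leq preindex_le.
rewrite -big_filter.
rewrite (perm_big [seq f p | p <- iota 0 n]).
  rewrite big_map /index_iota subn0 big_seq [RHS]big_seq; apply: eq_bigr => p.
  by rewrite mem_iota => pn; rewrite preindexK.
apply: uniq_perm; first by rewrite filter_uniq ?iota_uniq.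
  by rewrite map_inj_uniq ?iota_uniq //; apply: f_inj.
move=> q; rewrite mem_filter mem_index_iota /=; apply/andP/mapP => [[lt _]|[p]].
  by exists (preindex q); rewrite ?mem_iota ?preindex_lt.
by rewrite mem_iota => /= pn ->; rewrite preindexK // pn f_lt.
Qed.

Variable r : word.

(** The effect on words of pushing a monomial forward along the OI-morphism [f]
    and multiplying it by the monomial with exponents [r]. *)
Definition stretch (u : word) : word :=
  table c n' (fun i q => entry r i q + entry u i (preindex q))%N
    (fun q => mark u (preindex q)).

Lemma stretch_in u : word_in c (stretch u). Proof. exact: table_in. Qed.
Lemma size_stretch u : size (stretch u) = n'. Proof. exact: size_table. Qed.

Lemma wdeg_stretch u : size u = n -> word_in c u ->
  wdeg (stretch u) = (wdeg u + \sum_(q < n') \sum_(i < c) entry r i q)%N.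
Proof.
move=> un uc; rewrite (wdeg_entries (stretch_in u)) size_stretch (wdeg_entries uc) un.
rewrite -(big_preindex _ (G := fun p => \sum_(i < c) entry u i p)%N); last first.
  by rewrite big1 // => i _; rewrite entry_default ?un.
rewrite addnC -big_split; apply: eq_bigr => q _; rewrite -big_split.
by apply: eq_bigr => i _; rewrite entry_table.
Qed.

(** The first difference moves from column [p] to column [f p], where the same
    exponents get added on both sides. *)
Lemma stretch_lt u v : size u = n -> size v = n -> word_in c u -> word_in c v ->
  (word_key u < word_key v)%O -> (word_key (stretch u) < word_key (stretch v))%O.
Proof.
move=> un vn uc vc /(word_lt_key un vn uc vc)[p pn [H1 H2]].
apply/(word_lt_key (size_stretch u) (size_stretch v) (stretch_in u) (stretch_in v)).
exists (f p); first exact: f_lt.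
have nthS x q : (q < n')%N -> nth letter0 (stretch x) q =
    (mkseq (fun i => entry r i q + entry x i (preindex q))%N c, mark x (preindex q)).
  by move=> qn; rewrite nth_mkseq.
split=> [q qp|].
  have qn : (q < n')%N := ltn_trans qp (f_lt pn).
  rewrite !nthS // /entry /mark; have [lt|ge] := ltnP (preindex q) n.
    suff -> : nth letter0 u (preindex q) = nth letter0 v (preindex q) by [].
    apply: H1; rewrite -(preindex_lt lt) in qp.
    rewrite ltnNge leq_eqVlt; apply/negP => /orP[/eqP e|/f_incr lt'].
      by rewrite -e ltnn in qp.
    by rewrite ltnNge ltnW in qp.
  by rewrite (@nth_default _ letter0 u) ?un // (@nth_default _ letter0 v) ?vn.
have fpn := f_lt pn; rewrite !nthS // preindexK //.
have in_nth x : size x = n -> word_in c x -> letter_in c (nth letter0 x p).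
  by move=> xn /all_nthP; apply; rewrite xn.
have /(letter_lt_key (in_nth _ un uc) (in_nth _ vn vc)) := H2.
move=> H; apply/(letter_lt_key (c := c)); rewrite ?/letter_in /= ?size_mkseq //.
case: H => [lt|[e [i ic [H3 H4]]]]; [by left|right; split=> //].
exists i => //; split=> [k ki|].
  have kc := ltn_trans ki ic.
  by rewrite !nth_mkseq // /entry H3.
by rewrite !nth_mkseq // ltn_add2l.
Qed.
End Stretch.

(** If [u] embeds into [w] then [w] is a stretching of [u]: the exponents to
    add are the differences between [w] and [u]. *)
Lemma stretch_emb c u w f : {homo f : i j / (i < j)%N} ->
  (forall j, (j < size u)%N -> (f j < size w)%N) ->
  (forall j, (j < size u)%N ->
     letter_le (nth letter0 u j) (nth letter0 w (f j))) ->
  (forall q, (q < size w)%N -> (forall j, (j < size u)%N -> f j <> q) ->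
     mark w q = false) ->
  word_in c u -> word_in c w ->
  stretch c (size u) (size w) f (table c (size w) (fun i q =>
    entry w i q - entry u i (preindex (size u) f q))%N xpred0) u = w.
Proof.
move=> fi fs fle fm uc wc; apply: (@eq_word c); rewrite ?size_stretch ?stretch_in //.
  move=> i q ic qw; rewrite entry_table // entry_table //.
  have [lt|ge] := ltnP (preindex (size u) f q) (size u).
    rewrite subnK //; have /andP[_] := fle _ lt.
    rewrite preindex_lt // /mon_le all2E => /andP[/eqP sz].
    have sw : size (nth letter0 w q).1 = c by apply/eqP; move/all_nthP: wc; apply.
    move=> /(all_nthP (0%N, 0%N))/(_ i).
    by rewrite size_zip sz minnn sw nth_zip //=; apply.
  by rewrite (@entry_default u) // subn0 addn0.
move=> q qw; rewrite mark_table //.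
have [lt|ge] := ltnP (preindex (size u) f q) (size u).
  by have /andP[/eqP + _] := fle _ lt; rewrite preindex_lt.
rewrite mark_default // fm // => j ju fj; move: ge; rewrite -fj preindexK //.
by rewrite leqNgt ju.
Qed.

(** * Words as monomials and OI-morphisms *)

Section Monomials.
Variables (K : fieldType) (c : nat).

Lemma oi_alg_mapC m n (e : oi_hom m n) (a : K) :
  oi_alg_map e (a%:MP : oi_alg K c m) = a%:MP.
Proof. exact: comp_mpolyC. Qed.

Definition word_mono n (w : word) : oi_alg K c n :=
  \prod_(j < n) \prod_(i < c) oi_var K i j ^+ entry w i j.

Lemma oi_alg_map_word_mono m n (e : oi_hom m n) w :
  oi_alg_map e (word_mono m w) =
  \prod_(j < m) \prod_(i < c) oi_var K i (e j) ^+ entry w i j.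
Proof.
rewrite /oi_alg_map rmorph_prod; apply: eq_bigr => j _.
rewrite rmorph_prod; apply: eq_bigr => i _; rewrite rmorphXn; congr (_ ^+ _).
exact: oi_alg_map_var.
Qed.

(** Stretching is realized in the polynomial rings by x |-> r * e_*(x). *)
Lemma word_mono_stretch n n' (f : nat -> nat) (e : oi_hom n n') r u :
  {homo f : i j / (i < j)%N} -> (forall j, val (e j) = f j) -> size u = n ->
  word_mono n' (stretch c n n' f r u) = word_mono n' r * oi_alg_map e (word_mono n u).
Proof.
move=> fi ef un; rewrite oi_alg_map_word_mono.
pose varn (i : 'I_c) k : oi_alg K c n' :=
  if insub k is Some q then oi_var K i q else 1.
pose G p := \prod_(i < c) varn i (f p) ^+ entry u i p.
have f_lt j : (j < n)%N -> (f j < n')%N.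
  by move=> jn; have := valP (e (Ordinal jn)); rewrite ef.
have -> : \prod_(j < n) \prod_(i < c) oi_var K i (e j) ^+ entry u i j =
    \prod_(p < n) G p.
  apply: eq_bigr => p _; apply: eq_bigr => i _; congr (_ ^+ _).
  by rewrite /varn -ef valK.
rewrite -(big_preindex fi f_lt); last first.
  by rewrite /G big1 // => i _; rewrite entry_default ?un // expr0.
rewrite -big_split; apply: eq_bigr => q _; rewrite -big_split; apply: eq_bigr => i _ /=.
rewrite entry_table // exprD; congr (_ * _).
have [lt|ge] := ltnP (preindex n f q) n; last by rewrite entry_default ?un // !expr0.
by rewrite /varn (preindex_lt fi) // valK.
Qed.

Lemma homog_prod (I : Type) N (s : seq I) (F : I -> {mpoly K[N]}) (d : I -> nat) :
  (forall i, F i \is (d i).-homog) ->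
  \prod_(i <- s) F i \is (\sum_(i <- s) d i)%N.-homog.
Proof.
move=> Fd; elim: s => [|i s IH]; first by rewrite !big_nil dhomog1.
by rewrite !big_cons; apply: dhomogM.
Qed.

Lemma word_mono_homog n w : size w = n -> word_in c w ->
  word_mono n w \is (wdeg w).-homog.
Proof.
move=> wn wc; rewrite (wdeg_entries wc) wn.
apply: homog_prod => j; apply: homog_prod => i.
rewrite -[X in X.-homog]mul1n; apply: dhomogMn.
by rewrite /oi_var dhomogX /= mdeg1.
Qed.

Definition monomial_word n d (m : 'X_{1..c * n}) (e : oi_hom d n) : word :=
  table c n (fun i j => if (insub i : option 'I_c, insub j : option 'I_n)
                           is (Some i', Some j') then m (mxvec_index i' j') else 0%N)
    (fun j => j \in [seq val (e k) | k <- enum 'I_d]).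

Lemma word_mono_monomial n d m (e : oi_hom d n) :
  word_mono n (monomial_word m e) = 'X_[m].
Proof.
rewrite mpolyXE_id (reindex _ (curry_mxvec_bij _ _)) /= /word_mono exchange_big.
rewrite pair_bigA; apply: eq_bigr => -[i j] _ /=.
by rewrite entry_table // !valK.
Qed.

Lemma oi_alg_mapX m n (e : oi_hom m n) (u : 'X_{1..c * m}) :
  exists u' : 'X_{1..c * n}, oi_alg_map e ('X_[u] : oi_alg K c m) = 'X_[u'].
Proof.
rewrite /oi_alg_map comp_mpolyX.
exists (\sum_(k < c * m)
  (U_(mxvec_index (mxvec_unindex k).1 (e (mxvec_unindex k).2)) *+ u k))%MM.
rewrite -mprodXE; apply: eq_bigr => k _.
by rewrite tnth_mktuple /oi_var mpolyXn.
Qed.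

End Monomials.

Definition marks (w : word) : seq nat := [seq j <- iota 0 (size w) | mark w j].

(** An OI-morphism is determined by its image, so a word represents at most
    one. *)
Definition represents n d (e : oi_hom d n) (w : word) :=
  [seq val (e k) | k <- enum 'I_d] = marks w.

Lemma size_marks w : size (marks w) = nmarks w.
Proof.
have -> : nmarks w = count (fun x => x.2) (mkseq (nth letter0 w) (size w)).
  by rewrite mkseq_nth.
by rewrite size_filter count_map.
Qed.

Lemma represents_nmarks n d (e : oi_hom d n) w : represents e w -> nmarks w = d.
Proof. by move=> ew; rewrite -size_marks -ew size_map -cardE card_ord. Qed.

Lemma represents_uniq n d (e e' : oi_hom d n) w :
  represents e w -> represents e' w -> e = e'.
Proof.
rewrite /represents => <- /eq_in_map ee'; apply: val_inj; apply/ffunP => k.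
by apply/val_inj/esym/ee'; rewrite mem_enum.
Qed.

Lemma represents_exists n w : size w = n ->
  exists e : oi_hom (nmarks w) n, represents e w.
Proof.
move=> wn; have sm := size_marks w.
have mn k : (k < nmarks w)%N -> (nth 0%N (marks w) k < n)%N.
  rewrite -sm => /(mem_nth 0%N); rewrite mem_filter mem_iota add0n wn.
  by case/andP.
pose e0 := [ffun k : 'I_(nmarks w) => Ordinal (mn k (ltn_ord k))].
have e0i : [forall i : 'I_(nmarks w), forall j : 'I_(nmarks w),
    (i < j)%N ==> (e0 i < e0 j)%N].
  apply/forallP => i; apply/forallP => j; apply/implyP => ij; rewrite !ffunE /=.
  apply: (sorted_ltn_nth ltn_trans) => //; rewrite ?inE ?sm //.
  by apply: sorted_filter; [apply: ltn_trans|apply: iota_ltn_sorted].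
exists (OIHom e0i); rewrite /represents.
apply: (@eq_from_nth _ 0%N); first by rewrite size_map -cardE card_ord sm.
move=> k; rewrite size_map -cardE card_ord => kn.
rewrite (nth_map (Ordinal kn)) ?size_enum_ord //= ffunE /=.
by rewrite nth_enum_ord.
Qed.

Lemma oi_hom_sorted m n (e : oi_hom m n) : sorted ltn [seq val (e k) | k <- enum 'I_m].
Proof.
rewrite sorted_map; apply: (@sub_sorted _ (relpre val ltn)).
  by move=> i j /= ij; apply: oi_homP.
by rewrite -sorted_map val_enum_ord iota_ltn_sorted.
Qed.

Lemma represents_stretch c n n' d (f : nat -> nat) (e : oi_hom n n') r u
    (eu : oi_hom d n) :
  {homo f : i j / (i < j)%N} -> (forall j, val (e j) = f j) -> size u = n ->
  represents eu u -> represents (oi_comp e eu) (stretch c n n' f r u).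
Proof.
move=> fi ef un ru.
have f_lt j : (j < n)%N -> (f j < n')%N.
  by move=> jn; have := valP (e (Ordinal jn)); rewrite ef.
apply: (irr_sorted_eq ltn_trans ltnn (oi_hom_sorted _)).
  by apply: sorted_filter; [apply: ltn_trans|apply: iota_ltn_sorted].
move=> q; rewrite mem_filter mem_iota size_stretch add0n /=.
apply/mapP/andP => [[k _ ->]|[+ qn]].
  have : val (eu k) \in marks u by rewrite -ru; apply/mapP; exists k; rewrite ?mem_enum.
  rewrite mem_filter => /andP[mk _].
  by rewrite /= ffunE ef f_lt // mark_table ?f_lt // preindexK.
rewrite mark_table // => mq; have [lt|ge] := ltnP (preindex n f q) n; last first.
  by rewrite mark_default ?un in mq.
have : preindex n f q \in marks u by rewrite mem_filter mq mem_iota un lt.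
rewrite -ru => /mapP[k _ ek]; exists k; first by rewrite mem_enum.
by rewrite /= ffunE ef -ek (preindex_lt fi).
Qed.

Lemma represents_monomial_word c n d m (e : oi_hom d n) :
  represents e (@monomial_word c n d m e).
Proof.
apply: (irr_sorted_eq ltn_trans ltnn (oi_hom_sorted _)).
  by apply: sorted_filter; [apply: ltn_trans|apply: iota_ltn_sorted].
move=> q; rewrite mem_filter mem_iota size_table add0n /=.
apply/idP/andP => [qe|[+ qn]]; last by rewrite mark_table.
have qn : (q < n)%N by case/mapP: qe => k _ ->.
by rewrite mark_table.
Qed.

(** * The standard basis of an OI-module *)

Section Standard.
Variables (K : fieldType) (c : nat) (M : graded_oi_module K c).
Variables (ngen : nat) (width : nat -> nat).
Variables (gen : forall i, M (width i)) (gdeg : nat -> nat).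
Hypothesis gen_homog : forall i, (i < ngen)%N -> goi_comp (gdeg i)%:Z (gen i).
Hypothesis gen_generates : forall N : oi_subset M, is_oi_submodule N ->
  (forall i, (i < ngen)%N -> N _ (gen i)) -> forall n (q : M n), N n q.

(** The images of the generators, multiplied by monomials, span M over K; [l]
    is the degree. *)
Definition is_term n (l : nat) (x : M n) :=
  exists i (m : 'X_{1..c * n}) (e : oi_hom (width i) n),
  [/\ (i < ngen)%N, (mdeg m + gdeg i = l)%N & x = 'X_[m] *: oi_map e (gen i)].

Lemma terms_span n (q : M n) : pspan (fun x => exists l, is_term l x) q.
Proof.
move: n q.
apply: (gen_generates (N := fun n => pspan (fun x => exists l, is_term l x))).
  split.
  - by move=> n; apply: pspan0.
  - by move=> n x y; apply: pspanD.
  - move=> n a q qs; rewrite (mpolyE a) scaler_suml.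
    elim/big_ind: _ => [||u _]; [exact: pspan0|by move=> *; apply: pspanD|].
    rewrite -mul_mpolyC -scalerA; apply: pspanZ.
    apply: (pspan_map (op := fun x => 'X_[u] *: x)) qs
      => [x y|b x|_ [l [i [m [e [ik ml ->]]]]]].
    + exact: scalerDr.
    + by rewrite !scalerA mulrC.
    + exists (mdeg (u + m) + gdeg i)%N, i, (u + m)%MM, e; split=> //.
      by rewrite scalerA mpolyXD.
  - move=> m n e q qs; apply: (pspan_map (op := oi_map e)) qs
      => [x y|b x|_ [l [i [u [e' [ik ml ->]]]]]].
    + exact: oi_mapD.
    + by rewrite oi_mapZ oi_alg_mapC.
    + have [u' u'E] := oi_alg_mapX K e u.
      exists (mdeg u' + gdeg i)%N, i, u', (oi_comp e e'); split=> //.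
      by rewrite oi_mapZ u'E oi_map_comp.
move=> i ik; apply: pspan_mem.
exists (mdeg (0%MM : 'X_{1..c * width i}) + gdeg i)%N, i, 0%MM, (oi_id _).
by split=> //; rewrite mpolyX0 scale1r oi_map_id.
Qed.

Lemma term_homog n l (x : M n) : is_term l x -> goi_comp l%:Z x.
Proof.
move=> [i [m [e [ik <- ->]]]]; rewrite PoszD; apply: goi_compZ.
  by rewrite dhomogX.
exact/goi_map/gen_homog.
Qed.

Lemma pspan_homog n l (x : M n) : pspan (is_term l) x -> goi_comp l%:Z x.
Proof.
elim=> [|a y q Sy _ IH]; first exact: goi_comp0.
apply: goi_compD => //; rewrite -[l%:Z]add0r -[0]/(0%:Z).
apply: goi_compZ; last exact: term_homog.
by rewrite -[a%:MP]mulr1 mul_mpolyC; apply/dhomogZ/dhomog1.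
Qed.

Lemma homog_decomp n (q : M n) : exists N (u : nat -> M n),
  (forall l, pspan (is_term l) (u l)) /\ q = \sum_(l < N) u l.
Proof.
elim: (terms_span q) => [|a x {}q [l0 xl] _ [N [u [uP ->]]]].
  by exists 0%N, (fun=> 0); split=> [l|]; [exact: pspan0|rewrite big_ord0].
exists (maxn N l0.+1), (fun l => (if l == l0 then a%:MP *: x else 0) +
  (if (l < N)%N then u l else 0)).
split=> [l|].
  apply: pspanD; last by case: ifP => // _; apply: pspan0.
  by case: eqP => [->|_]; [exact/pspanZ/pspan_mem|apply: pspan0].
rewrite big_split /=; congr (_ + _).
  have l0max : (l0 < maxn N l0.+1)%N := leq_maxr N l0.+1.
  by rewrite -big_mkcond (big_pred1 (Ordinal l0max)).
rewrite -big_mkcond -(big_mkord xpredT) -(big_mkord (fun l => l < N)%N).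
rewrite (big_cat_nat (n := N)) ?leq_maxl //= [X in _ + X]big_nat_cond.
rewrite [X in _ + X]big1 ?addr0 => [|l /andP[/andP[le _] lt]]; last first.
  by have := leq_trans lt le; rewrite ltnn.
rewrite big_nat_cond [RHS]big_nat_cond; apply: eq_bigl => l.
by case: (l < N)%N; rewrite ?andbF.
Qed.

(** In an expansion into homogeneous parts, a homogeneous element equals the
    part of its own degree because the sum of the components is direct. *)
Lemma homog_uniq n (q : M n) (j : int) N (u : nat -> M n) :
  goi_comp j q -> (forall l, goi_comp l%:Z (u l)) -> q = \sum_(l < N) u l ->
  q = if j is Posz l then (if (l < N)%N then u l else 0) else 0.
Proof.
move=> qj uh qE.
pose F (z : int) : M n :=
  if z is Posz l then (if (l < N)%N then u l else 0) else 0.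
pose w (z : int) : M n := F z - (if z == j then q else 0).
(* the degree [j] itself may be negative or at least [N] *)
pose s := undup (j :: [seq Posz l | l <- iota 0 N]).
have js : j \in s by rewrite mem_undup mem_head.
have wh z : goi_comp z (w z).
  rewrite /w; apply: goi_compD.
    rewrite /F; case: z => [l|l]; last exact: goi_comp0.
    by case: ifP => _; [apply: uh|apply: goi_comp0].
  case: eqP => [->|_]; last by rewrite oppr0; apply: goi_comp0.
  rewrite -[j]add0r -[0]/(0%:Z) -scaleN1r; apply: goi_compZ => //.
  by rewrite dhomogN dhomog1.
have sum0 : \sum_(z <- s) w z = 0.
  have sumF : \sum_(z <- [seq Posz l | l <- iota 0 N]) F z = q.
    rewrite big_map -[X in iota 0 X]subn0 big_mkord qE.
    by apply: eq_bigr => l _; rewrite /F ltn_ord.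
  rewrite /w sumrB [X in _ - X](_ : _ = q); last first.
    by rewrite (bigD1_seq j) ?undup_uniq //= eqxx big1 ?addr0 // => z /negPf->.
  rewrite /s /= undup_id; last first.
    by rewrite map_inj_uniq ?iota_uniq // => x y [].
  case: ifP => jl; first by rewrite sumF subrr.
  rewrite big_cons sumF (_ : F j = 0) ?add0r ?subrr //.
  rewrite /F; case: j jl {qj s js wh w} => // l.
  by rewrite mem_map ?mem_iota => [/= ->|x y []].
have := goi_direct (undup_uniq _) wh sum0 js.
by rewrite /w eqxx => /eqP; rewrite subr_eq0 => /eqP <-.
Qed.

Definition item := (nat * word)%type.

(** A word with the wrong number of marks gets the vector 0, so that it can
    never be standard. *)
Definition word_vec n (x : item) : M n :=
  match excluded_middle_informative
    (exists e : oi_hom (width x.1) n, represents e x.2) with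
  | left H => word_mono K c n x.2 *:
      oi_map (proj1_sig (constructive_indefinite_description _ H)) (gen x.1)
  | right _ => 0
  end.

Lemma word_vecE n i w (e : oi_hom (width i) n) : represents e w ->
  word_vec n (i, w) = word_mono K c n w *: oi_map e (gen i).
Proof.
move=> ew; rewrite /word_vec.
case: excluded_middle_informative => [H|[]]; last by exists e.
by case: constructive_indefinite_description => e' /= /(represents_uniq ew) <-.
Qed.

Lemma word_vec0 n i w : nmarks w <> width i -> word_vec n (i, w) = 0.
Proof.
move=> ne; rewrite /word_vec; case: excluded_middle_informative => // H.
by exfalso; case: H => e /= /represents_nmarks.
Qed.

(** The degree of such a pair is that of its vector: the degree of the word plus
    that of the generator. *)
Definition items n j : seq item :=
  [seq (i, w) | i <- iota 0 ngen,
     w <- if (gdeg i <= j)%N then words c n (j - gdeg i) else [::]].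

Lemma mem_items n j i w : ((i, w) \in items n j) =
  [&& (i < ngen)%N, size w == n, word_in c w & (wdeg w + gdeg i == j)%N].
Proof.
apply/allpairsPdep/and4P => [[i' [w' [/[!mem_iota] ik + [-> ->]]]]|[ik sw wc ej]].
  case: ifP => // le; rewrite mem_words => /and3P[-> -> /eqP ->].
  by rewrite subnK.
exists i, w; rewrite mem_iota; split=> //.
by rewrite -(eqP ej) leq_addl addnK mem_words sw wc eqxx.
Qed.

Lemma uniq_items n j : uniq (items n j).
Proof.
apply: allpairs_uniq_dep; first exact: iota_uniq.
  by move=> i _; case: ifP => // _; apply: uniq_words.
by move=> [i w] [i' w'] _ _ /= [-> ->].
Qed.

Definition item_key (x : item) : nat *l seqlexi (seqlexi nat) := (x.1, word_key x.2).

Lemma item_key_inj : injective item_key.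
Proof. by move=> [i w] [i' w'] [-> /word_key_inj->]. Qed.

Lemma item_key_lt i u i' w : (item_key (i, u) < item_key (i', w))%O =
  (i <= i')%O && ((i' <= i)%O ==> (word_key u < word_key w)%O).
Proof. by rewrite ltEprodlexi. Qed.

Lemma word_vec_homog n j x : x \in items n j -> goi_comp j%:Z (word_vec n x).
Proof.
case: x => i w; rewrite mem_items => /and4P[ik /eqP sw wc /eqP <-].
rewrite /word_vec; case: excluded_middle_informative => H; last exact: goi_comp0.
rewrite PoszD; apply: goi_compZ; first exact: word_mono_homog.
exact/goi_map/gen_homog.
Qed.

Lemma kspan_homog n j xs (q : M n) : (forall x, x \in xs -> goi_comp j x) ->
  kspan xs q -> goi_comp j q.
Proof.
elim: xs q => [|x xs IH] q xsj /=; first by move->; apply: goi_comp0.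
move=> [a /IH H]; rewrite -[q](subrK (a%:MP *: x)); apply: goi_compD.
  by apply: H => y yxs; apply: xsj; rewrite inE yxs orbT.
rewrite -[j]add0r -[0]/(0%:Z); apply: goi_compZ; last exact/xsj/mem_head.
by rewrite -[a%:MP]mulr1 mul_mpolyC; apply/dhomogZ/dhomog1.
Qed.

Lemma term_word n j x : is_term j x -> x \in map (word_vec n) (items n j).
Proof.
move=> [i [m [e [ik <- ->]]]]; apply/mapP; exists (i, monomial_word m e).
  rewrite mem_items ik size_table eqxx table_in /=.
  have := @word_mono_homog K c n (monomial_word m e)
    (size_table _ _ _ _) (table_in _ _ _ _).
  by rewrite word_mono_monomial dhomogX => /eqP <-.
by rewrite (word_vecE (represents_monomial_word _ _)) word_mono_monomial.
Qed.

Lemma comp_span n j (q : M n) :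
  goi_comp j%:Z q <-> kspan (map (word_vec n) (items n j)) q.
Proof.
split=> [qj|]; last first.
  by apply: kspan_homog => _ /mapP[x xin ->]; apply: word_vec_homog.
have [N [u [uP qE]]] := homog_decomp q.
rewrite (homog_uniq qj (fun l => pspan_homog (uP l)) qE).
case: ifP => _; last exact: kspan0.
by apply: pspan_kspan (uP j) => x /term_word; apply: kspan_mem.
Qed.

Lemma comp_neg n j (q : M n) : j < 0 -> goi_comp j q -> q = 0.
Proof.
move=> j0 qj; have [N [u [uP qE]]] := homog_decomp q.
by rewrite (homog_uniq qj (fun l => pspan_homog (uP l)) qE); case: j j0 {qj}.
Qed.

Definition standard_word (i : nat) (w : word) : bool :=
  standard item_key (word_vec (size w)) (items (size w) (wdeg w + gdeg i)) (i, w).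

Lemma standard_word_nmarks i w : standard_word i w -> nmarks w = width i.
Proof.
move=> /asboolP ns; apply: NNPP => /word_vec0 e; apply: ns; rewrite e.
exact: kspan0.
Qed.

(** Let [w] be the stretching of [u] given by an OI-morphism [e] and a
    monomial r.  The map q |-> r * e_*(q) is linear and sends the vector of a
    word to the vector of its stretching.  So a relation expressing the vector
    of [u] by smaller ones is carried to such a relation for [w], as stretching
    preserves the strict order. *)
Lemma standard_word_emb i u w : (i < ngen)%N -> word_in c w -> emb u w ->
  nmarks u = width i -> nmarks w = width i -> standard_word i w -> standard_word i u.
Proof.
move=> ik wc uw mu mw /asboolP nsw; apply/asboolP => su; apply: nsw.
have uc : word_in c u by apply: emb_in uw wc.
have [f [fi fs fle fm]] := emb_increasing uw (etrans mu (esym mw)).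
set n := size u in su fs fle fm *; set n' := size w in fs fle fm *.
pose r := table c n'
  (fun i q => entry w i q - entry u i (preindex n f q))%N xpred0.
pose T := stretch c n n' f r.
have Tu : T u = w by apply: stretch_emb.
pose e0 := [ffun p : 'I_n => Ordinal (fs p (ltn_ord p))].
have e0i : [forall i : 'I_n, forall j : 'I_n, (i < j)%N ==> (e0 i < e0 j)%N].
  apply/forallP => p; apply/forallP => q; apply/implyP => pq; rewrite !ffunE.
  exact: fi.
pose e := OIHom e0i.
have ef p : val (e p) = f p by rewrite /= ffunE.
pose op (q : M n) : M n' := word_mono K c n' r *: oi_map e q.
have opE i' v : size v = n -> nmarks v = width i' ->
    op (word_vec n (i', v)) = word_vec n' (i', T v).
  move=> vn mv; have := represents_exists vn; rewrite mv => -[ev rv].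
  rewrite (word_vecE rv) (word_vecE (represents_stretch c r fi ef vn rv)).
  rewrite /op oi_mapZ scalerA oi_map_comp; congr (_ *: _).
  by rewrite /T (word_mono_stretch _ _ _ fi ef vn).
have -> : word_vec n' (i, w) = op (word_vec n (i, u)) by rewrite opE // Tu.
apply: (kspan_map (op := op)) su => [x y|a q|_ /mapP[[i' v] + ->]].
- by rewrite /op oi_mapD scalerDr.
- by rewrite /op oi_mapZ oi_alg_mapC !scalerA mulrC.
rewrite mem_filter mem_items => /andP[lt /and4P[i'k /eqP vn vc /eqP vdeg]].
have [mv|mv] := eqVneq (nmarks v) (width i'); last first.
  rewrite word_vec0; last exact/eqP.
  rewrite (_ : op 0 = 0); first exact: kspan0.
  by rewrite /op -[0](scale0r 0) oi_mapZ -mpolyC0 oi_alg_mapC mpolyC0 scale0r scaler0.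
rewrite opE //; apply/kspan_mem/map_f.
rewrite mem_filter mem_items i'k size_stretch stretch_in eqxx /=.
apply/andP; split.
  move: lt; rewrite !item_key_lt => /andP[-> /= /implyP lt]; apply/implyP => /lt.
  by rewrite -Tu; apply: stretch_lt.
rewrite -{1}Tu /T !(wdeg_stretch fi fs) //; apply/eqP; lia.
Qed.

(** Higman's order may delete marks, so the standard words alone need not form
    a downset.  Adding all words with fewer marks than the width of the
    generator repairs this, and these words form a downset themselves. *)
Definition few_marks d (w : word) := (nmarks w < d)%N.

Lemma few_marks_downset d : downset c (few_marks d).
Proof. by move=> u w _ /emb_nmarks le; apply: leq_ltn_trans. Qed.

Lemma standard_word_downset i : (i < ngen)%N ->
  downset c (fun w => standard_word i w || few_marks (width i) w).
Proof.
move=> ik u w wc uw /orP[sw|fw]; last by rewrite (few_marks_downset wc uw fw) orbT.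
have mw := standard_word_nmarks sw.
have := emb_nmarks uw; rewrite mw /few_marks leq_eqVlt.
case/orP=> [/eqP mu|->]; last by rewrite orbT.
by rewrite (standard_word_emb ik wc uw mu mw sw).
Qed.

Lemma standard_word_rational i : (i < ngen)%N ->
  rational c (word_series c (standard_word i)).
Proof.
move=> ik; have L1 := downset_rational (d := width i) (standard_word_downset ik).
have L2 := downset_rational (d := width i) (@few_marks_downset (width i)).
apply: rational_ext (rationalD (L1 _) (rationalM (-1) (L2 _))).
- move=> N n j ltn ltj; rewrite mulN1r !coefB !coef_word_series // /count_words.
  have := count_predUI (standard_word i) (few_marks (width i)) (words c n j).
  rewrite -[count (predU _ _) _]/(count (fun w =>
    standard_word i w || few_marks (width i) w) _).
  rewrite [count (predI _ _) _](_ : _ = 0%N) ?addn0 => [->|].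
    by rewrite PoszD addrK.
  apply/eqP; rewrite -leqn0 leqNgt -has_count; apply/hasPn => w _ /=.
  by apply/negP => /andP[/standard_word_nmarks e]; rewrite /few_marks e ltnn.
- by move=> w _ /orP[/standard_word_nmarks <-|/ltnW]; first exact: leqnn.
- by move=> w _ /ltnW.
Qed.

Definition hilbert_function n (j : int) : nat :=
  if j is Posz l then count (fun x => standard_word x.1 x.2) (items n l) else 0%N.

Lemma hilbertP : is_hilbert_series M hilbert_function.
Proof.
move=> n [j|j] /=.
  apply: has_dim_ext (fun q => iff_sym (comp_span j q)) _.
  rewrite (_ : count _ _ =
      count (standard item_key (word_vec n) (items n j)) (items n j)).
    exact: has_dim_standard item_key_inj _ (uniq_items n j).
  apply: eq_in_count => -[i w]; rewrite mem_items => /and4P[_ /eqP sw _ /eqP <-].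
  by rewrite /standard_word /= sw.
apply: has_dim_ext (@has_dim_kspan_nil _ _ _) => q /=; split=> [->|/comp_neg->//].
exact: goi_comp0.
Qed.

Lemma hilbert_sum n j : hilbert_function n (Posz j) =
  (\sum_(i <- iota 0 ngen) if (gdeg i <= j)%N
     then count_words c (standard_word i) n (j - gdeg i) else 0)%N.
Proof.
rewrite /hilbert_function count_flatten sumnE !big_map; apply: eq_bigr => i _.
by rewrite count_map; case: ifP.
Qed.

Definition hilbert_series (N : nat) : {poly {poly int}} :=
  \poly_(n < N) \poly_(j < N) (hilbert_function n (Posz j))%:Z.

(** The standard words of generator [i] enter with a shift by its degree. *)
Lemma hilbert_rational : rational c hilbert_series.
Proof.
apply: (@rational_ext c (fun N => \sum_(i <- iota 0 ngen)
  ('X^(gdeg i))%:P * word_series c (standard_word i) N)).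
  move=> N n j ltn ltj; rewrite !coef_poly ltn coef_poly ltj hilbert_sum !coef_sum.
  rewrite -natz natr_sum; apply: eq_bigr => i _.
  rewrite coefCM coefXnM ltnNge; case: leqP => //= le.
  by rewrite coef_word_series ?natz // (leq_ltn_trans (leq_subr _ _) ltj).
apply: rational_sum_in => i; rewrite mem_iota => ik.
exact/rationalM/standard_word_rational.
Qed.

Lemma hilbert_fraction : exists (a b : nat) (cs : 'I_b -> nat)
    (g : {poly {poly int}}) (f : 'I_b -> {poly int}),
  [/\ forall j, (cs j <= c)%N, forall j, 0 < (f j).[1], forall j, (f j).[0] = 1
    & is_fraction hilbert_function g (hilbert_denom a cs f)].
Proof.
have [a [ds [g [dsP H]]]] := hilbert_rational.
have dsi i : factor_ok c (tnth (in_tuple ds) i) by apply/dsP/mem_tnth.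
exists a, (size ds), (fun i => (tnth (in_tuple ds) i).1), g,
  (fun i => (tnth (in_tuple ds) i).2); split; try by move=> i; case: (dsi i).
split=> [n [j|j] //|n j].
have -> : hilbert_denom a (fun i => (tnth (in_tuple ds) i).1)
    (fun i => (tnth (in_tuple ds) i).2) = denom a ds.
  by rewrite /hilbert_denom /denom big_tnth.
rewrite -(H (maxn n j).+1) ?ltnS ?leq_maxl ?leq_maxr //.
rewrite coefM coef_sum; apply: eq_bigr => p _.
rewrite [RHS]coefM; apply: eq_bigr => q _.
by rewrite coef_poly ifT ?coef_poly ?ifT //; lia.
Qed.
End Standard.

(** Each member of a finite generating set lies in the submodule generated by
    finitely many of the given homogeneous elements; together these are
    finitely many homogeneous generators. *)
Lemma finite_homogeneous_generators (K : fieldType) (c : nat)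
    (M : graded_oi_module K c) :
  oi_finitely_generated M -> goi_generated_nonneg M ->
  exists t : seq {n : nat & M n},
    (forall x, x \in t -> exists j : nat, goi_comp j%:Z (tagged x)) /\
    oi_generates (fun n (q : M n) => existT (fun n => M n) n q \in t).
Proof.
move=> [s sgen] [S [Sgen Shom]].
pose hom (t : seq {n : nat & M n}) :=
  forall x, x \in t -> exists j : nat, goi_comp j%:Z (tagged x).
pose gen_by (t : seq {n : nat & M n}) n (q : M n) :=
  forall N : oi_subset M, is_oi_submodule N ->
    (forall n (q : M n), existT (fun n => M n) n q \in t -> N n q) -> N n q.
have hom_cat t t' : hom t -> hom t' -> hom (t ++ t').
  by move=> h h' x; rewrite mem_cat => /orP[/h|/h'].
have gen_catl t t' n (q : M n) : gen_by t n q -> gen_by (t ++ t') n q.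
  by move=> g N NP Nt; apply: g => // m x xt; apply: Nt; rewrite mem_cat xt.
have gen_catr t t' n (q : M n) : gen_by t' n q -> gen_by (t ++ t') n q.
  by move=> g N NP Nt; apply: g => // m x xt; apply: Nt; rewrite mem_cat xt orbT.
have each n (q : M n) : exists2 t, hom t & gen_by t n q.
  move: n q; apply: (Sgen (fun n q => exists2 t, hom t & gen_by t n q)).
    split.
    - by move=> n; exists [::] => // N [N0 _ _ _] _; apply: N0.
    - move=> n x y [t th tx] [t' th' ty]; exists (t ++ t'); first exact: hom_cat.
      move=> N NP Nt; apply: (oi_subD NP).
        exact: (gen_catl t t').
      exact: (gen_catr t t').
    - move=> n a q [t th tq]; exists t => // N NP Nt.
      by apply: (oi_subZ NP); apply: tq.
    - move=> m n e q [t th tq]; exists t => // N NP Nt.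
      by apply: (oi_sub_map NP); apply: tq.
  move=> n q Sq; exists [:: existT (fun n => M n) n q].
    move=> x; rewrite inE => /eqP->; have [j j0 qj] := Shom n q Sq.
    by case: j j0 qj => // j _ qj; exists j.
  by move=> N NP; apply; rewrite mem_head.
have [t th tgen] : exists2 t, hom t & forall x, x \in s -> gen_by t (tag x) (tagged x).
  elim: s {sgen} => [|x s [t th tg]]; first by exists [::].
  have [t' th' tg'] := each _ (tagged x); exists (t' ++ t); first exact: hom_cat.
  move=> y; rewrite inE => /orP[/eqP->|/tg]; [exact: gen_catl|exact: gen_catr].
by exists t; split=> // N NP Nt; apply: (sgen N NP) => n q /tgen; apply.
Qed.

Theorem theorem5p9 (K : fieldType) (c : nat) (hc : (1 <= c)%N)
    (M : graded_oi_module K c)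
    (hfg : oi_finitely_generated M) (hnonneg : goi_generated_nonneg M) :
  exists H : nat -> int -> nat, is_hilbert_series M H /\
  exists (a b : nat) (cs : 'I_b -> nat) (g : {poly {poly int}})
         (f : 'I_b -> {poly int}),
    [/\ forall j, (cs j <= c)%N,
        forall j, 0 < (f j).[1],
        forall j, (f j).[0] = 1
      & is_fraction H g (hilbert_denom a cs f)].
Proof.
have [t [thom tgen]] := finite_homogeneous_generators hfg hnonneg.
pose x0 : {n : nat & M n} := existT (fun n => M n) 0%N 0.
have /ClassicalEpsilon.choice[gdeg gdegP] : forall i, exists j : nat, (i < size t)%N ->
    goi_comp j%:Z (tagged (nth x0 t i)).
  move=> i; case: ltnP => [it|_]; last by exists 0%N.
  by have [j] := thom _ (mem_nth x0 it); exists j.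
pose gen i := tagged (nth x0 t i).
have gen_all (N : oi_subset M) : is_oi_submodule N ->
  (forall i, (i < size t)%N -> N _ (gen i)) -> forall n (q : M n), N n q.
  move=> NP Ng; apply: (tgen N NP) => n q /(nthP x0)[i it e].
  by have := Ng i it; rewrite /gen e.
exists (hilbert_function (size t) gen gdeg); split.
  exact: hilbertP.
exact: hilbert_fraction.
Qed.
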